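(* Let $n\ge1$. For every $w\in\mathrm{NC}_n$ we have $\mathrm{QFl}_n\cap BwB=M_{\mathrm{NC}}(w)B$, and $$\mathrm{QFl}_n=\bigsqcup_{w\in\mathrm{NC}_n}M_{\mathrm{NC}}(w)B .$$ Moreover, if for any total ordering $w_1,w_2,\dots,w_{|\mathrm{NC}_n|}$ of $\mathrm{NC}_n$ that extends the Bruhat order we set $X_k=\bigcup_{i=1}^kM_{\mathrm{NC}}(w_i)B$, then each $X_k$ is closed, $X_1\subseteq X_2\subseteq\cdots\subseteq X_{|\mathrm{NC}_n|}=\mathrm{QFl}_n$, and $X_{k+1}\setminus X_k=M_{\mathrm{NC}}(w_{k+1})B$.
   Context: Work over $\mathbb{C}$. $\mathrm{Fl}_m=\mathrm{GL}_m/B_m$ ($B=B_m$ upper triangular) is the variety of complete flags in $\mathbb{C}^m$, $hB$ corresponding to the flag whose $j$th subspace is the span of the first $j$ columns of $h$. A permutation $w$ is identified with the matrix having $1$'s in positions $(w(j),j)$; $BwB$ is regarded as a subset of $\mathrm{Fl}_n$. Noncrossing partitions: $w\in S_n$ lies in $\mathrm{NC}_n$ if every cycle of its disjoint cycle decomposition has the form $(b_1\,b_2\cdots b_r)$ with $b_1>\cdots>b_r$, and the underlying sets of the cycles (fixed points included) form a noncrossing set partition of $\{1,\dots,n\}$ (no distinct $a,b$ in one block and distinct $c,d$ in another with $a<c<b<d$). $\mathrm{Inv}(w)=\{(i,j): i<j,\ w(i)>w(j)\}$, and for $w\in\mathrm{NC}_n$ the noncrossing inversion set is $\mathrm{Inv}_{\mathrm{NC}}(w)=\{(i,j)\in\mathrm{Inv}(w):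 w(i\,j)\in\mathrm{NC}_n\}$, where $w(i\,j)$ is the product of $w$ with the transposition $(i\,j)$. For $w\in\mathrm{NC}_n$, $M_{\mathrm{NC}}(w)$ is the set of all matrices with entry $1$ in position $(w(i),i)$ for each $i$, an arbitrary complex number in position $(w(j),i)$ for each $(i,j)\in\mathrm{Inv}_{\mathrm{NC}}(w)$, and $0$ elsewhere; $M_{\mathrm{NC}}(w)B\subset\mathrm{Fl}_n$ is the set of flags represented by these matrices. Quasisymmetric flag variety: $e_1,\dots,e_m$ is the standard basis of $\mathbb{C}^m$ and $\epsilon_i:\mathbb{C}^{m-1}\to\mathbb{C}^m$ inserts a $0$ as the $i$th coordinate. For $Z\subset \mathrm{Fl}_{m-1}$ and $1\le i\le m-1$, $\mathbb{P}_iZ\subset \mathrm{Fl}_m$ is the set of flags $\mathcal{G}$ for which there is $\mathcal{F}\in Z$ with $\mathcal{G}_j=\epsilon_i(\mathcal{F}_j)$ for $j<i$ and $\mathcal{G}_j=\epsilon_i(\mathcal{F}_{j-1})\oplus\langle e_i\rangle$ for $j>i$ ($\mathcal{G}_i$ arbitrary). $\mathrm{QFl}_n\subset\mathrm{Fl}_n$ is the union of $\mathbb{P}_{i_{n-1}}\cdots\mathbb{P}_{i_1}\mathrm{Fl}_1$ over all sequences $(i_1,\dots,i_{n-1})$ with $1\le i_j\le j$ (these sets are the varieties $X(T)$ indexed by planar binary trees $T$ with $n$ leaves). *)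

(* Defs.v *)
From HB Require Import structures.
From mathcomp Require Import all_boot all_order all_algebra all_fingroup.
From mathcomp Require Import classical_sets reals.
From mathcomp Require Export complex.
From mathcomp Require mpoly.

Set Implicit Arguments.
Unset Strict Implicit.
Unset Printing Implicit Defensive.

Import GRing.Theory.
Local Open Scope classical_set_scope.
Local Open Scope ring_scope.

(* Coordinates of the space of column vectors of size n, and the points on
   which permutations act, are numbered from 0: coordinate i : 'I_n stands for
   the (i + 1)-st coordinate in the usual 1-based numbering.  Subspaces of a
   flag are indexed by their dimension. *)

Section Flags.
Variable F : fieldType.

(* Families V_0, ..., V_n of subspaces of F^n; a complete flag is one satisfying
   [is_flag]. *)
Definition subspaces n := {ffun 'I_n.+1 -> {vspace 'cV[F]_n}}.

Definition is_flag n (V : subspaces n) : Prop :=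
  (forall j : 'I_n.+1, \dim (V j) = j) /\
  (forall j k : 'I_n.+1, (j <= k)%N -> (V j <= V k)%VS).

Definition Fl n : set (subspaces n) := [set V | is_flag V].

(* The flag hB represented by an invertible matrix h. *)
Definition flag_of n (h : 'M[F]_n) : subspaces n :=
  [ffun j : 'I_n.+1 => <<[seq col k h | k : 'I_n <- enum 'I_n & (k < j)%N]>>%VS].

Definition borel n : set 'M[F]_n :=
  [set b | b \in unitmx /\ forall i j : 'I_n, (j < i)%N -> b i j = 0].

(* Zariski closed subsets of Fl n, for the quotient topology on GL_n / B: the
   preimage in GL_n is cut out by polynomials in the n * n matrix entries. *)
Definition zariski_closed n (Z : set (subspaces n)) : Prop :=
  Z `<=` @Fl n /\
  exists E : set (mpoly.mpoly (n * n) F),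
    forall h : 'M[F]_n, h \in unitmx ->
      (Z (flag_of h) <->
       forall p, E p -> mpoly.meval (fun k => mxvec h 0 k) p = 0).

(* The basis vector e_i, and the insertion of a zero at coordinate i. *)
Definition basis_vec n (i : 'I_n) : 'cV[F]_n := delta_mx i 0.

Definition ins0_mx n (i : 'I_n.+1) : 'M[F]_(n.+1, n) :=
  \matrix_(k, l) (k == lift i l)%:R.

Definition ins0 n (i : 'I_n.+1) : 'Hom('cV[F]_n, 'cV[F]_n.+1) :=
  linfun (mulmx (ins0_mx i)).

Lemma ins0_lift n (i : 'I_n.+1) (v : 'cV[F]_n) l :
  ins0 i v (lift i l) 0 = v l 0.
Proof.
rewrite lfunE mxE (bigD1 l) //= mxE eqxx mul1r big1 ?addr0 // => k nkl.
by rewrite mxE (inj_eq lift_inj) eq_sym (negbTE nkl) mul0r.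
Qed.

Lemma ins0_diag n (i : 'I_n.+1) (v : 'cV[F]_n) : ins0 i v i 0 = 0.
Proof.
by rewrite lfunE mxE big1 // => k _; rewrite mxE (negbTE (neq_lift _ _)) mul0r.
Qed.

(* The operation P_{i+1} from subsets of Fl n to subsets of Fl n.+1.  As i : 'I_n,
   the inserted coordinate is never the last one, and the unconstrained subspace
   of the flag G is the one of dimension i.+1. *)
Definition Pins n (i : 'I_n) (Z : set (subspaces n)) : set (subspaces n.+1) :=
  let c := widen_ord (leqnSn n) i : 'I_n.+1 in
  [set G | is_flag G /\ exists V, [/\ Z V,
    forall j : 'I_n.+2, (j < i.+1)%N -> G j = (ins0 c @: V (inord j))%VS &
    forall j : 'I_n.+2, (i.+1 < j)%N ->
      G j = (ins0 c @: V (inord j.-1) + <[basis_vec c]>)%VS]].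

(* P_{i_m} ... P_{i_1} Fl_1, a subset of Fl m.+1; the 1-based i_{j+1} <= j + 1 is
   encoded as i j : 'I_j.+1, and only i 0, ..., i (m - 1) are used. *)
Fixpoint Pseq (i : forall j, 'I_j.+1) m : set (subspaces m.+1) :=
  match m with
  | 0 => @Fl 1
  | k.+1 => Pins (i k) (@Pseq i k)
  end.

(* The case n = 0 is junk. *)
Definition QFl n : set (subspaces n) :=
  match n with
  | 0 => set0
  | m.+1 => \bigcup_(i in [set: forall j, 'I_j.+1]) @Pseq i m
  end.

End Flags.

Arguments Fl F n : clear implicits.
Arguments borel F n : clear implicits.
Arguments QFl F n : clear implicits.

Section NoncrossingPartitions.
Variable n : nat.
Implicit Types w : 'S_n.

(* The permutation w acts on the block C as the cycle (b_1 b_2 ... b_r) with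
   b_1 > ... > b_r. *)
Definition decreasing_cycle w (C : {set 'I_n}) : bool :=
  [exists s : #|C|.-tuple 'I_n,
    [&& sorted (fun a b : 'I_n => (b < a)%N) s, [set x in s] == C & fcycle w s]].

Definition noncrossing (P : {set {set 'I_n}}) : bool :=
  [forall C in P, forall D in P, (C != D) ==>
    [forall a in C, forall b in C, forall c in D, forall d in D,
      ~~ [&& (a < c)%N, (c < b)%N & (b < d)%N]]].

Definition NC : {set 'S_n} :=
  [set w | [forall C in porbits w, decreasing_cycle w C] &
           noncrossing (porbits w)].

Definition Inv w : {set 'I_n * 'I_n} :=
  [set ij : 'I_n * 'I_n | (ij.1 < ij.2)%N & (w ij.2 < w ij.1)%N].

(* w (i j), acting by (i j) first: in MathComp the left factor of a product of
   permutations acts first. *)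
Definition rtransp w (i j : 'I_n) : 'S_n := (tperm i j * w)%g.

Definition InvNC w : {set 'I_n * 'I_n} :=
  [set ij in Inv w | rtransp w ij.1 ij.2 \in NC].

(* Reflexive transitive closure of u -> u (i j) whenever the length (number of
   inversions) increases. *)
Definition bruhat : rel 'S_n :=
  connect [rel u v : 'S_n | [exists i, exists j, v == rtransp u i j] &&
                     (#|Inv u| < #|Inv v|)%N].

End NoncrossingPartitions.

Section Cells.
Variables (F : fieldType) (n : nat).
Implicit Types w : 'S_n.

(* Entries 1 at (w j, j); this is the transpose of MathComp's [perm_mx w]. *)
Definition permutation_matrix w : 'M[F]_n := \matrix_(i, j) (i == w j)%:R.

Definition bruhat_cell w : set (subspaces F n) :=
  [set V | exists b1 b2, [/\ borel F n b1, borel F n b2 &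
     V = flag_of (b1 *m permutation_matrix w *m b2)]].

(* Rows are written w j, so that every position occurs exactly once. *)
Definition MNC w : set 'M[F]_n :=
  [set A | (forall i, A (w i) i = 1) /\
           (forall i j, i != j -> (i, j) \notin InvNC w -> A (w j) i = 0)].

Definition MNCB w : set (subspaces F n) := @flag_of F n @` MNC w.

End Cells.

Arguments bruhat_cell F {n} w.
Arguments MNC F {n} w.
Arguments MNCB F {n} w.

(* Main.v *)
Require Import Defs.
From mathcomp Require Import all_boot all_order all_algebra all_fingroup.
From mathcomp Require Import boolp classical_sets reals.
From mathcomp Require Import zify.
From mathcomp Require mpoly.
Import -(notations) mpoly.

(** Everything rests on a recursive description of the cells that matches the
    recursive definition of QFl.

    A permutation is noncrossing exactly when it stabilises the open interval
    below each descent x -> w x and the closed interval above each ascent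
    ([NC_stableP]); this criterion only compares positions, so it is easy to
    check after a local change.  Pick consecutive points i, i + 1.  Every
    noncrossing v other than the identity arises from a smaller noncrossing w by
    one of two moves ([NC_growth]): insert i just below the minimum i + 1 of a
    block (then v sends i + 1 to i), or insert i as a singleton block directly
    below a point i + 1 that is not the minimum of its block.  A shortest descent
    onto the minimum of a block shows where to cut.

    On matrices, the flags of P_i(flag of A) are those that agree, outside the
    dimension i, with the flag of the matrix obtained from A by inserting the
    column e_i after column i and a row that is zero in all other columns
    ([PinsP]).  The free subspace runs over a projective line: its points are
    given by the matrices with column i equal to A_i + c e_i, and one more, with
    columns e_i, A_i ([flag_between]).  In a matrix of a cell, column i is a basis vector as soon
    as w(i) < i ([MNC_descent_col]), because a noncrossing inversion (i, j) forces
    i <= w(i).  This turns each point of the line into a matrix of the cell of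
    one of the two permutations grown from w ([Pins_MNC]), and conversely each
    matrix of a cell represents such a point ([MNC_Pins]).  By induction QFl is the
    union of the cells of noncrossing permutations ([QFlP]).

    The matrices of the cell of w are b w with b unitriangular, so that cell
    lies in BwB.  The ranks of the lower left corners of a matrix are constant on
    BwB and determine w ([bruhat_cell_rank], [dominated_anti]); hence the cells
    are disjoint and QFl meets BwB in the cell of w.

    For closedness, the union of the first k cells is the part of QFl where, for
    some i < k, all corner ranks are at most those of w_i: a noncrossing v
    whose corner ranks are bounded by those of w_i lies below w_i in the Bruhat
    order ([dominated_bruhat]), hence comes before it in the ordering.
    Rank bounds are closed since they are vanishing conditions on minors.  QFl is
    closed since P_i preserves closedness ([zclosed_Pins]): the smaller flag can
    be read off from a matrix h by deleting row i and one of the columns i, i + 1,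
    and a polynomial condition on it, multiplied by the determinant of this
    submatrix, is a polynomial condition on h.

    Below, coordinates are numbered from 0: the points i and i + 1 of this
    explanation are [low i] and [high i], and the free subspace has dimension
    i.+1. *)

Set Implicit Arguments.
Unset Strict Implicit.
Unset Printing Implicit Defensive.

Import GRing.Theory.
Local Open Scope classical_set_scope.
Local Open Scope ring_scope.

(** * Noncrossing partitions as permutations that stabilise intervals *)

Section Stable.
Variable n : nat.
Implicit Types (w u : 'S_n) (x y : 'I_n).

(** The orbit-free form of the noncrossing condition.  If [w x < x], then [w x]
    and [x] are neighbours in a decreasing cycle, and no block may leave the gap
    between them; if [x <= w x], they are the minimum and the maximum of a block,
    and no block may leave the interval that this block spans. *)
Definition interval_stable w : Prop :=
  forall x y,
    ((w x < x)%N -> (w x < y < x)%N -> (w x < w y < x)%N) /\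
    ((x <= w x)%N -> (x <= y <= w x)%N -> (x <= w y <= w x)%N).

Lemma stable_porbit w (P : pred 'I_n) x y :
  (forall z, P z -> P (w z)) -> P x -> y \in porbit w x -> P y.
Proof.
move=> Pw Px /porbitP [k ->]; elim: k => [|k IH]; first by rewrite expg0 perm1.
by rewrite expgSr permM; apply: Pw.
Qed.

(** The orbit of a point of a stable interval stays in the interval.  As [x] is
    not in the open gap below it, its orbit avoids the gap. *)
Lemma stable_cycle w x y : interval_stable w -> y \in porbit w x ->
  if (w x < x)%N then ~~ (w x < y < x)%N else (x <= y <= w x)%N.
Proof.
move=> Hw yx; case: ltnP => wx.
  apply/negP=> Hy.
  have := stable_porbit (P := fun z : 'I_n => (w x < z < x)%N) (fun z => (Hw x z).1 wx) Hy.
  move=> /(_ x); rewrite porbit_sym => /(_ yx); lia.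
apply: (stable_porbit (P := fun z : 'I_n => (x <= z <= w x)%N) (fun z => (Hw x z).2 wx) _ yx).
lia.
Qed.

(** Splitting the decreasing list of the cycle at [x] shows what [w x] is: the
    next smaller element, or, at the end of the list, the first and largest
    one. *)
Lemma decreasing_cycleP w x y : decreasing_cycle w (porbit w x) ->
  y \in porbit w x ->
  if (w x < x)%N then ~~ (w x < y < x)%N else (x <= y <= w x)%N.
Proof.
case/existsP=> s /and3P [sd /eqP/setP sC cs] yx.
have ys : y \in tval s by have := sC y; rewrite inE yx.
have xs : x \in tval s by have := sC x; rewrite inE porbit_id.
move: sd; rewrite sorted_pairwise; last by move=> a b c /= h1 h2; apply: ltn_trans h2 h1.
case/splitPr: {sC} xs cs ys => s1 s2 cs ys.
rewrite pairwise_cat pairwise_cons => /and3P [/allrelP s12 s1d /andP [/allP s2x s2d]].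
have ys1 : y \in s1 -> (x < y)%N by move=> h; apply: s12 => //; rewrite mem_head.
move: ys; rewrite mem_cat inE.
case: s2 s2x s12 s2d cs => [|z s2] s2x s12 s2d cs.
  rewrite orbF => ys.
  case: s1 cs s12 s1d ys ys1 => [|h t] /=.
    rewrite andbT => /eqP -> _ _ /=; rewrite ltnn => /eqP -> _; lia.
  rewrite rcons_cat cat_path /= => /and3P [_ _ /andP [/eqP wx _]] s12.
  move=> /andP [/allP ht _] ys ys1; rewrite wx.
  have xh : (x < h)%N by apply: s12; rewrite mem_head.
  rewrite ltnNge ltnW //=; case/orP: ys ys1; last by move/eqP => ->; lia.
  by rewrite inE => yt ys1; have := ys1 yt; case/orP: yt => [/eqP -> | /ht]; lia.
have zx : (z < x)%N by apply: s2x; rewrite mem_head.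
have -> : w x = z.
  case: s1 cs {s12 ys1 s1d} => [|h t] /=; first by case/andP => /eqP.
  by rewrite rcons_cat cat_path /= => /and4P [_ _ /eqP].
rewrite zx; case/or3P => [/ys1 h|/eqP ->|]; [lia|lia|].
rewrite inE; case/andP: s2d => /allP s2z _.
by case/orP => [/eqP ->|/s2z]; lia.
Qed.

(** The list is the orbit sorted decreasingly; [stable_cycle] identifies the image
    of each element with its successor in the list. *)
Lemma decreasing_cycleI w x : interval_stable w -> decreasing_cycle w (porbit w x).
Proof.
move=> Hw; set C := porbit w x; pose gt := fun a b : 'I_n => (b < a)%N.
pose ge := fun a b : 'I_n => (b <= a)%N.
pose s := sort ge (enum C).
have su : uniq s by rewrite sort_uniq enum_uniq.
have sz : size s == #|C| by rewrite size_sort cardE.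
have sC y : (y \in s) = (y \in C) by rewrite mem_sort mem_enum.
have sge : sorted ge s by apply: sort_sorted => a b; apply: leq_total.
have sgt : pairwise gt s.
  rewrite -sorted_pairwise; last by move=> a b c /= h1 h2; apply: ltn_trans h2 h1.
  elim: (s) sge su => //= a [|b t] IH //=.
  case/andP=> ab /IH {}IH; rewrite inE negb_or => /andP [/andP [nab _] /IH /= ->].
  by rewrite andbT /gt ltn_neqAle eq_sym nab.
apply/existsP; exists (Tuple sz) => /=; apply/and3P; split.
- by rewrite sorted_pairwise //; move=> a b c /= h1 h2; apply: ltn_trans h2 h1.
- by apply/eqP/setP=> y; rewrite inE sC.
(* It is enough to compare [w] with the successor map of the cyclic list. *)
have /eq_in_cycle -> // : {in s &, frel w =2 frel (next s)}; last exact: cycle_next.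
move=> a b /[!sC] aC bC /=; congr (_ == _).
have wC y : y \in C -> w y \in C.
  by case/porbitP=> k ->; rewrite -permM -expgSr mem_porbit.
have sub_stable y : y \in C -> y \in porbit w a.
  by move=> yC; rewrite -(eqP (_ : porbit w x == porbit w a)) // eq_sym eq_porbit_mem.
have Hc y := stable_cycle Hw (y := y) (x := a).
have as_ : a \in s by rewrite sC.
clearbody s; case/splitPr: {sz sge} as_ su sC sgt => s1 s2 su sC.
rewrite pairwise_cat pairwise_cons => /and3P [/allrelP s12 s1d /andP [/allP s2x s2d]].
have s1x y : y \in s1 -> (a < y)%N by move=> h; apply: s12 => //; rewrite mem_head.
have := sC (w a); rewrite wC // mem_cat inE => was.
have -> : next (s1 ++ a :: s2) a = head (head a s1) s2.
  rewrite next_nth mem_cat mem_head orbT.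
  have as1 : a \notin s1 by apply/negP => /s1x; rewrite ltnn.
  case: (s1) as1 => [|h t] /=; first by rewrite eqxx nth0.
  rewrite inE negb_or eq_sym => /andP [/negbTE -> at_].
  by rewrite index_cat (negbTE at_) /= eqxx addn0 nth_cat ltnNge leqnSn subSnn /= nth0.
have {}sC y : y \in s1 ++ a :: s2 -> y \in porbit w a by rewrite sC; apply: sub_stable.
have mem2 y : y \in s2 -> y \in porbit w a.
  by move=> ys; apply: sC; rewrite mem_cat inE ys !orbT.
case: s2 {su s12} sC s2x s2d was mem2 => [|z s2] /= sC s2x s2d was mem2.
  have aw : (a <= w a)%N by case/or3P: was => // [/s1x /ltnW //|/eqP ->].
  have Hle y : y \in porbit w a -> (y <= w a)%N.
    by move/Hc; rewrite ltnNge aw => /andP [].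
  case: s1 sC s1d s1x was => [|h t] /= sC s1d s1x; first by rewrite orbF => /eqP.
  have hw : (h <= w a)%N by apply/Hle/sC; rewrite mem_head.
  have ah : (a < h)%N by apply: s1x; rewrite mem_head.
  rewrite orbF inE => was; apply/val_inj/eqP; rewrite /= eqn_leq hw andbT.
  case/andP: s1d => /allP ht _.
  by case/orP: was => [/orP [/eqP ->//|/ht /ltnW]|/eqP ->] //; apply: ltnW.
have za : (z < a)%N by apply: s2x; rewrite mem_head.
have := Hc z (mem2 z (mem_head _ _)); case: ltnP => wa; last lia.
move=> nz; case/or3P: was => [/s1x|/eqP e|]; [lia|by rewrite e ltnn in wa|].
rewrite inE => /orP [/eqP //|]; case/andP: s2d => /allP zs _ /zs; rewrite /gt; lia.
Qed.

(** A block leaving one of the intervals crosses the block of the ends of that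
    interval.  Conversely, if a < c < b < d is a crossing of the blocks C (of a
    and b) and D (of c and d), the least element of C above c is a descent whose
    gap contains c, hence D, but not d. *)
Lemma NC_stableP w : reflect (interval_stable w) (w \in NC n).
Proof.
rewrite inE; apply: (iffP andP) => [[/forall_inP dc nx]|Hw].
  have {}dc x y : y \in porbit w x -> 
      if (w x < x)%N then ~~ (w x < y < x)%N else (x <= y <= w x)%N.
    by apply/decreasing_cycleP/dc/imset_f.
  have porb x : porbit w x \in porbits w by apply: imset_f.
  have wx x : w x \in porbit w x by have := mem_porbit w 1 x; rewrite expg1.
  have {}nx x y a b c d : porbit w x != porbit w y -> a \in porbit w x ->
      b \in porbit w x -> c \in porbit w y -> d \in porbit w y ->
      (a < c)%N -> (c < b)%N -> (b < d)%N -> False.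
    move=> nxy ax bx cy dy ac cb bd.
    move/forall_inP: nx => /(_ _ (porb x)) /forall_inP /(_ _ (porb y)).
    rewrite nxy /= => /forall_inP /(_ a ax) /forall_inP /(_ b bx).
    by move=> /forall_inP /(_ c cy) /forall_inP /(_ d dy); rewrite ac cb bd.
  move=> x y.
  have [yx|nyx] := boolP (y \in porbit w x).
    have wyx : w y \in porbit w x.
      by rewrite -(eqP (_ : porbit w y == porbit w x)) // eq_porbit_mem.
    by have := dc _ _ yx; have := dc _ _ wyx; case: ltnP => h h1 h2; split; lia.
  have nwyx : w y \notin porbit w x.
    apply: contra nyx => h; rewrite porbit_sym -(eqP (_ : porbit w (w y) == porbit w y)).
      by rewrite porbit_sym.
    by rewrite eq_porbit_mem.
  have n1 : w y <> x :> nat by move=> /val_inj e; rewrite e porbit_id in nwyx.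
  have n2 : w y <> w x :> nat by move=> /val_inj e; rewrite e wx in nwyx.
  have n3 : y <> x :> nat by move=> /val_inj e; rewrite e porbit_id in nyx.
  have n4 : y <> w x :> nat by move=> /val_inj e; rewrite e wx in nyx.
  have yxn : porbit w y != porbit w x by rewrite eq_porbit_mem.
  have xyn : porbit w x != porbit w y by rewrite eq_sym.
  have A1 := nx y x (w y) y (w x) x yxn (wx y) (porbit_id _ _) (wx x) (porbit_id _ _).
  have A2 := nx x y (w x) x y (w y) xyn (wx x) (porbit_id _ _) (porbit_id _ _) (wx y).
  have A3 := nx y x (w y) y x (w x) yxn (wx y) (porbit_id _ _) (porbit_id _ _) (wx x).
  have A4 := nx x y x (w x) y (w y) xyn (porbit_id _ _) (wx x) (porbit_id _ _) (wx y).
  split=> h1 h2.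
    have [l1|] := ltnP (w x) (w y); have [l2|] := ltnP (w y) x => //.
    - by move=> l; case: A2; lia.
    - by move=> l; case: A1; lia.
    - lia.
  have [l1|] := leqP x (w y); have [l2|] := leqP (w y) (w x) => //.
  - by move=> l; case: A4; lia.
  - by move=> l; case: A3; lia.
  - lia.
split; first by apply/forall_inP=> _ /imsetP [x _ ->]; apply: decreasing_cycleI.
apply/forall_inP=> _ /imsetP [x _ ->]; apply/forall_inP=> _ /imsetP [y _ ->].
apply/implyP=> nxy; apply/forall_inP=> a ax; apply/forall_inP=> b bx.
apply/forall_inP=> c cy; apply/forall_inP=> d dy; apply/negP=> /and3P [ac cb bd].
pose P z := (z \in porbit w x) && (c < z)%N.
have Pb : P b by rewrite /P bx.
case: (arg_minnP (fun z : 'I_n => z : nat) Pb) => z /andP [zx cz] zmin.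
have eqz : porbit w x = porbit w z by apply/esym/eqP; rewrite eq_porbit_mem.
have eqc : porbit w y = porbit w c by apply/esym/eqP; rewrite eq_porbit_mem.
have wzx : w z \in porbit w x by rewrite eqz; have := mem_porbit w 1 z; rewrite expg1.
have := stable_cycle Hw (x := z) (y := a); rewrite -eqz => /(_ ax).
case: ltnP => wz; last lia.
move=> _; have wzc : (w z < c)%N.
  rewrite ltn_neqAle; apply/andP; split.
    apply: contra nxy => /eqP/val_inj e; rewrite e in wzx.
    by rewrite eqc eq_sym eq_porbit_mem.
  by rewrite leqNgt; apply/negP=> h; have := zmin (w z); rewrite /P wzx h => /(_ isT); lia.
have hc : (w z < c < z)%N by rewrite wzc.
have := stable_porbit (P := fun t : 'I_n => (w z < t < z)%N) (fun t => (Hw z t).1 wz) hc (y := d).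
rewrite -eqc => /(_ dy).
have := zmin b; rewrite /P bx cb => /(_ isT); lia.
Qed.

End Stable.

(** * Growing a noncrossing partition by one point *)

Section Growth.
Variable n : nat.
Implicit Types (w u : 'S_n) (i : 'I_n).

Definition low i : 'I_n.+1 := widen_ord (leqnSn n) i.
Definition high i : 'I_n.+1 := lift ord0 i.

(** In terms of blocks, the points from [i] on are shifted up by one to make room
    for a new point [low i]: [add_point] makes it a singleton block, [add_below]
    puts it in the block of [high i], as the image of [high i]. *)
Definition add_point w i : 'S_n.+1 := lift_perm (low i) (low i) w.
Definition add_below w i : 'S_n.+1 := lift_perm (high i) (low i) w.

(** Lifting is increasing, so the conditions at the lifted points are those for
    [w].  The interval attached to the new point of the domain has no other point
    to check, and each interval of another point that contains the new point
    contains its image. *)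
Lemma NC_add_point w i : (add_point w i \in NC n.+1) = (w \in NC n).
Proof.
apply/NC_stableP/NC_stableP => Hw x y.
  have := Hw (lift (low i) x) (lift (low i) y).
  rewrite !lift_perm_lift /= /bump; split; lia.
case: (unliftP (low i) x) (unliftP (low i) y) => [x' ->|->] [y' ->|->];
  rewrite ?lift_perm_lift ?lift_perm_id /= /bump; try lia.
by have := Hw x' y'; split; lia.
Qed.

Lemma NC_add_below w i : (add_below w i \in NC n.+1) = (w \in NC n).
Proof.
apply/NC_stableP/NC_stableP => Hw x y.
  have := Hw (lift (high i) x) (lift (high i) y).
  rewrite !lift_perm_lift /= /bump; split; lia.
case: (unliftP (high i) x) (unliftP (high i) y) => [x' ->|->] [y' ->|->];
  rewrite ?lift_perm_lift ?lift_perm_id /= /bump; try lia.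
by have := Hw x' y'; split; lia.
Qed.

Lemma lift_permP (p q : 'I_n.+1) (v : 'S_n.+1) : v p = q ->
  exists w, v = lift_perm p q w.
Proof.
move=> vp.
have inj : injective (fun k => odflt k (unlift q (v (lift p k)))).
  move=> a b; have nq c : q != v (lift p c).
    by rewrite -vp (inj_eq perm_inj) neq_lift.
  case: (unlift_some (nq a)) => a' ea ->; case: (unlift_some (nq b)) => b' eb -> /= e.
  by apply/(@lift_inj _ p)/(@perm_inj _ v); rewrite ea eb e.
exists (perm inj); apply/permP=> k; case: (unliftP p k) => [k' ->|->].
  rewrite lift_perm_lift permE; case: unliftP => [j //|/= e].
  by move/eqP: e; rewrite -vp (inj_eq perm_inj) eq_sym (negbTE (neq_lift _ _)).
by rewrite lift_perm_id vp.
Qed.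

Lemma rtransp_lift (p q : 'I_n.+1) w (a b : 'I_n) :
  rtransp (lift_perm p q w) (lift p a) (lift p b) = lift_perm p q (rtransp w a b).
Proof.
apply/permP=> k; rewrite /rtransp !permM; case: (unliftP p k) => [j ->|->].
  rewrite lift_perm_lift permM; case: (tpermP a b j) => [->|->|/eqP ja /eqP jb].
  - by rewrite tpermL lift_perm_lift.
  - by rewrite tpermR lift_perm_lift.
  by rewrite tpermD ?lift_perm_lift // (inj_eq lift_inj) eq_sym.
by rewrite tpermD ?lift_perm_id // eq_sym neq_lift.
Qed.

Lemma Inv_lift (p q : 'I_n.+1) w (a b : 'I_n) :
  ((lift p a, lift p b) \in Inv (lift_perm p q w)) = ((a, b) \in Inv w).
Proof. by rewrite !inE /= !lift_perm_lift /= /bump; lia. Qed.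

Lemma InvNC_add_point w i a b :
  ((lift (low i) a, lift (low i) b) \in InvNC (add_point w i)) = ((a, b) \in InvNC w).
Proof. by rewrite [LHS]inE [RHS]inE Inv_lift /= rtransp_lift NC_add_point. Qed.

Lemma InvNC_add_below w i a b :
  ((lift (high i) a, lift (high i) b) \in InvNC (add_below w i)) = ((a, b) \in InvNC w).
Proof. by rewrite [LHS]inE [RHS]inE Inv_lift /= rtransp_lift NC_add_below. Qed.


Lemma low_lift i : low i = lift (high i) i.
Proof. by apply/val_inj; rewrite /= /bump; lia. Qed.

Lemma high_lift i : high i = lift (low i) i.
Proof. by apply/val_inj; rewrite /= /bump; lia. Qed.

Lemma add_below_lift w i j : add_below w i (lift (high i) j) = lift (low i) (w j).
Proof. exact: lift_perm_lift. Qed.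

Lemma add_below_high w i : add_below w i (high i) = low i.
Proof. exact: lift_perm_id. Qed.

Lemma add_below_low w i : add_below w i (low i) = lift (low i) (w i).
Proof. by rewrite [X in add_below w i X]low_lift add_below_lift. Qed.

Lemma add_point_lift w i j : add_point w i (lift (low i) j) = lift (low i) (w j).
Proof. exact: lift_perm_lift. Qed.

Lemma add_point_low w i : add_point w i (low i) = low i.
Proof. exact: lift_perm_id. Qed.

Lemma add_point_high w i : add_point w i (high i) = lift (low i) (w i).
Proof. by rewrite [X in add_point w i X]high_lift add_point_lift. Qed.

(** The two ways to grow [w] differ by the transposition of the new point and its
    successor.  If [w] is noncrossing, so are both results, and the longer one has
    ([low i], [high i]) as a noncrossing inversion. *)
Lemma rtransp_add_below w i :
  rtransp (add_below w i) (low i) (high i) = add_point w i.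
Proof.
apply/permP=> k; rewrite /rtransp permM.
case: (tpermP (low i) (high i) k) => [->|->|/eqP kl /eqP kh].
- by rewrite add_below_high add_point_low.
- by rewrite add_below_low add_point_high.
case: (unliftP (low i) k) kl kh => [j ->|->]; last by rewrite eqxx.
move=> _ kh; have e : lift (low i) j = lift (high i) j.
  by apply/val_inj; move: kh; rewrite -(inj_eq val_inj) /= /bump; lia.
by rewrite [in LHS]e add_below_lift add_point_lift.
Qed.

Lemma rtransp_add_point w i :
  rtransp (add_point w i) (low i) (high i) = add_below w i.
Proof.
by rewrite -rtransp_add_below /rtransp mulgA tperm2 mul1g.
Qed.

End Growth.

Section InvNC.
Variable n : nat.
Implicit Types (w u : 'S_n) (i k : 'I_n).

Lemma InvNCP w i k : reflect [/\ (i < k)%N, (w k < w i)%N & rtransp w i k \in NC n]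
  ((i, k) \in InvNC w).
Proof. by rewrite [_ \in InvNC w]inE [_ \in Inv w]inE -andbA /=; apply: and3P. Qed.

Lemma rtranspL w i k : rtransp w i k i = w k.
Proof. by rewrite permM tpermL. Qed.

Lemma rtranspR w i k : rtransp w i k k = w i.
Proof. by rewrite permM tpermR. Qed.

Lemma rtranspD w i k j : j != i -> j != k -> rtransp w i k j = w j.
Proof. by move=> ji jk; rewrite permM tpermD // eq_sym. Qed.

(** If [w i < i], then [rtransp w i k] sends [k] down to [w i], and the gap between
    them contains [i], which is sent to [w k], outside the gap. *)
Lemma InvNC_ascent w i k : (i, k) \in InvNC w -> (i <= w i)%N.
Proof.
case/InvNCP=> ik wki /NC_stableP /(_ k i) [+ _]; rewrite rtranspL rtranspR => H.
by rewrite leqNgt; apply/negP=> wi; lia.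
Qed.

(** A decreasing cycle has only one ascent, from its minimum to its maximum. *)
Lemma NC_ascent2 u k : u \in NC n -> (k < u k)%N -> (u k < u (u k))%N -> False.
Proof. by move/NC_stableP/(_ k (u k)) => [_ H]; lia. Qed.

End InvNC.

Section Shape.
Variable n : nat.
Implicit Types (w : 'S_n) (i : 'I_n).

(** The three lemmas below locate the free entries in the new rows and columns of
    the matrices of a cell.  Any further noncrossing inversion would
    create two successive ascents or a gap that a block leaves. *)
Lemma add_below_row w i k : (low i <= add_below w i (low i))%N ->
  (k, high i) \in InvNC (add_below w i) -> k = low i.
Proof.
set v := add_below w i => vi /InvNCP [kh vk uNC].
apply/eqP/negP => /negP kl.
have vh : v (high i) = low i by rewrite /v /add_below lift_perm_id.
have hl : low i != high i by rewrite high_lift neq_lift.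
case: (@NC_ascent2 _ _ k uNC); rewrite rtranspL vh.
  by move: kh kl; rewrite -(inj_eq val_inj) /= /bump; lia.
rewrite rtranspD // 1?eq_sym // ltn_neqAle vi andbT.
rewrite (inj_eq val_inj) -{1}vh (inj_eq perm_inj) eq_sym.
by rewrite hl.
Qed.

Lemma add_point_row w i k : (k, low i) \notin InvNC (add_point w i).
Proof.
apply/negP=> /InvNCP [kl vk uNC].
have vl : add_point w i (low i) = low i by rewrite /add_point lift_perm_id.
case: (@NC_ascent2 _ _ k uNC); rewrite rtranspL ?vl //.
by rewrite rtranspR -{1}vl.
Qed.

Lemma add_point_col w i k : (add_point w i (high i) < low i)%N ->
  (low i, k) \in InvNC (add_point w i) -> k = high i.
Proof.
set v := add_point w i => vh /InvNCP [lk vk uNC].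
apply/eqP/negP => /negP kh.
have vl : v (low i) = low i by rewrite /v /add_point lift_perm_id.
have hl : high i != low i by rewrite high_lift eq_sym neq_lift.
have [H _] := (NC_stableP _ uNC) k (high i).
move: H; rewrite rtranspR vl (rtranspD _ hl) 1?eq_sym //.
move: kh vh lk; rewrite -(inj_eq val_inj) /= /bump; lia.
Qed.

End Shape.

Section ShortDescent.
Variables (n : nat) (w : 'S_n).
Hypothesis wNC : w \in NC n.

(** Among the descents in a stable set, one with the least image ends at the
    minimum of its block: otherwise its image would be a descent with a smaller
    image. *)
Lemma NC_moved_descent (P : pred 'I_n) y : (forall z, P z -> P (w z)) ->
  P y -> w y != y -> exists z, [/\ P z, (w z < z)%N & (w z <= w (w z))%N].
Proof.
move=> stP Py wy.
have [z0 Pz0] : exists z : 'I_n, P z && (w z < z)%N.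
  have [wlt|wge] := ltnP (w y) y; first by exists y; rewrite Py.
  exists (w y); rewrite stP //= ltnNge; apply/negP=> wwy.
  apply: (NC_ascent2 wNC (k := y)).
    by rewrite ltn_neqAle wge andbT eq_sym.
  rewrite ltn_neqAle wwy andbT (inj_eq val_inj); apply: contra wy => /eqP/perm_inj <-.
  by rewrite eqxx.
case: (@arg_minnP _ z0 (fun z => P z && (w z < z)%N) (fun z => w z : nat) Pz0).
move=> z /andP [Pz wz] zmin.
exists z; split=> //; rewrite leqNgt; apply/negP=> wwz.
by have := zmin (w z); rewrite stP // wwz => /(_ isT); lia.
Qed.

(** A descent [x] onto the minimum of a block, with [x - w x] least: a moved point
    in its gap would yield a shorter descent of this kind inside the gap. *)
Lemma NC_short_descent : w != 1%g ->
  exists x : 'I_n, [/\ (w x < x)%N, (w x <= w (w x))%N &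
    forall y : 'I_n, (w x < y < x)%N -> w y = y].
Proof.
move=> nw1; have /NC_stableP Hw := wNC.
pose P x := (w x < x)%N && (w x <= w (w x))%N.
have [x0 Px0] : exists x, P x.
  have [y wy] : exists y, w y != y.
    apply/existsP; apply: contraNT nw1 => /existsPn H.
    by apply/eqP/permP=> y; rewrite perm1; apply/eqP; rewrite -[_ == _]negbK.
  have [//|z [_ h1 h2]] := @NC_moved_descent predT y _ isT wy.
  by exists z; rewrite /P h1.
case: (@arg_minnP _ x0 P (fun x => x - w x)%N Px0) => x /andP [wx wwx] xmin.
exists x; split=> // y yx; apply/eqP/negPn/negP=> wy.
have [z [zx wz wwz]] := NC_moved_descent (fun z => (Hw x z).1 wx) yx wy.
have := (Hw x z).1 wx zx; have := xmin z; rewrite /P wz wwz => /(_ isT); lia.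
Qed.

End ShortDescent.

(** Cut next to the upper end [x] of a shortest descent.  Either its image is the
    point just below [x], or that point is in the gap, hence fixed. *)
Lemma NC_growth n (v : 'S_n.+1) : v \in NC n.+1 ->
  v = 1%g \/ exists w i, w \in NC n /\
    (v = add_below w i /\ (i <= w i)%N \/
     v = add_point w i /\ (w i < i)%N).
Proof.
move=> vNC; have [->|nv1] := eqVneq v 1%g; [by left|right].
have [x [vx vvx fixv]] := NC_short_descent vNC nv1.
have x1n : (x.-1 < n)%N by have := ltn_ord x; lia.
pose i := Ordinal x1n.
have xh : x = high i by apply/val_inj; rewrite /= /bump; lia.
have [vl|vl] := eqVneq (v x) (low i).
  rewrite xh in vl; have [w vw] := lift_permP vl.
  exists w, i; split; first by rewrite -(NC_add_below w i) -[add_below w i]vw.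
  left; split=> //; move: vvx; rewrite xh vl vw -[lift_perm _ _ _]/(add_below w i).
  by rewrite add_below_low /= /bump; lia.
have vi : v (low i) = low i.
  by apply: fixv; move: vl; rewrite -(inj_eq val_inj) /=; lia.
have [w vw] := lift_permP vi.
exists w, i; split; first by rewrite -(NC_add_point w i) -[add_point w i]vw.
right; split=> //; move: vx vl; rewrite xh vw -[lift_perm _ _ _]/(add_point w i).
by rewrite add_point_high -(inj_eq val_inj) /= /bump; lia.
Qed.

(** * Flags represented by matrices *)

Section Flags.
Variable F : fieldType.

Lemma col_mulmx m n p (A : 'M[F]_(m, n)) (B : 'M_(n, p)) l :
  col l (A *m B) = A *m col l B.
Proof. by rewrite !colE mulmxA. Qed.

Section OneSize.
Variable n : nat.
Implicit Types (h g : 'M[F]_n) (j : 'I_n.+1) (k l : 'I_n) (U : {vspace 'cV[F]_n}).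

Lemma flag_of_subP h j U :
  reflect (forall k, (k < j)%N -> col k h \in U) (flag_of h j <= U)%VS.
Proof.
rewrite ffunE; apply: (iffP span_subvP) => H.
  move=> k kj; apply: H; apply: map_f.
  by rewrite mem_filter kj mem_enum.
by move=> _ /mapP [k /[!mem_filter] /andP [kj _] ->]; apply: H.
Qed.

Lemma col_in_flag h j k : (k < j)%N -> col k h \in flag_of h j.
Proof. by move: k; apply/flag_of_subP. Qed.

Lemma flag_of_mul h g j (gj : forall k l, (l < j)%N -> (j <= k)%N -> g k l = 0) :
  (flag_of (h *m g) j <= flag_of h j)%VS.
Proof.
apply/flag_of_subP => l lj.
have -> : col l (h *m g) = \sum_k g k l *: col k h.
  by apply/colP=> i; rewrite !mxE summxE; apply: eq_bigr => k _; rewrite !mxE mulrC.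
apply: rpred_sum => k _; have [kj|jk] := ltnP k j; first by rewrite rpredZ ?col_in_flag.
by rewrite gj // scale0r rpred0.
Qed.

Lemma flag_of_mono h : {homo flag_of h : j k / (j <= k)%N >-> (j <= k)%VS}.
Proof.
move=> j k jk; apply/flag_of_subP => l lj; apply: col_in_flag; exact: leq_trans jk.
Qed.

Lemma flag_of_full h : h \in unitmx -> flag_of h ord_max = fullv.
Proof.
move=> hu; apply/eqP; rewrite eqEsubv subvf /=; apply/subvP=> v _.
have -> : v = \sum_k (invmx h *m v) k 0 *: col k h.
  rewrite -[LHS](mulKVmx hu); apply/colP=> i; rewrite mxE summxE.
  by apply: eq_bigr => k _; rewrite !mxE mulrC.
by apply: rpred_sum => k _; rewrite rpredZ ?col_in_flag.
Qed.

Lemma dim_flag_of h j : h \in unitmx -> \dim (flag_of h j) = j.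
Proof.
move=> hu; have jn : (j <= n)%N by rewrite -ltnS.
pose S := [seq k : 'I_n <- enum 'I_n | (k < j)%N].
have szS : size S = j.
  rewrite size_filter; have -> : count (fun k : 'I_n => (k < j)%N) (enum 'I_n) =
    count (fun k : nat => (k < j)%N) (map val (enum 'I_n)) by rewrite count_map.
  rewrite val_enum_ord -size_filter -(@eq_filter _ (fun k : nat => k < 0 + j)%N) //.
  by rewrite filter_iota_ltn // size_iota.
pose S' := [seq k : 'I_n <- enum 'I_n | ~~ (k < j)%N].
have szS' : size S' = (n - j)%N.
  apply/eqP; rewrite -(eqn_add2l j) subnKC // -{1}szS /S /S' !size_filter.
  by rewrite count_predC size_enum_ord.
have /dimvS : (fullv <= flag_of h j + <<[seq col k h | k <- S']>>)%VS.
  rewrite -(flag_of_full hu); apply/flag_of_subP => k _; have [kj|jk] := ltnP k j.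
    by apply: (subvP (addvSl _ _)); apply: col_in_flag.
  apply: (subvP (addvSr _ _)); apply: memv_span; apply: map_f.
  by rewrite mem_filter -leqNgt jk mem_enum.
rewrite dimvf /dim /= muln1 => H.
have H1 := leq_trans H (dimv_add_leqif _ _).1.
have H2 : (\dim (flag_of h j) <= j)%N.
  by rewrite ffunE (leq_trans (dim_span _)) // size_map szS.
have H3 : (\dim <<[seq col k h | k <- S']>> <= n - j)%N.
  by rewrite (leq_trans (dim_span _)) // size_map szS'.
by apply/eqP; rewrite eqn_leq H2 -(leq_add2r (n - j)) subnKC // (leq_trans H1) // leq_add2l.
Qed.

Lemma flag_of_is_flag h : h \in unitmx -> is_flag (flag_of h).
Proof. by move=> hu; split=> [j|]; [exact: dim_flag_of|exact: flag_of_mono]. Qed.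

Lemma flag_of_eqP h h' j : h \in unitmx -> h' \in unitmx ->
  (forall k, (k < j)%N -> col k h \in flag_of h' j) -> flag_of h j = flag_of h' j.
Proof.
move=> hu hu' H; apply/eqP; rewrite eqEdim !dim_flag_of // leqnn andbT.
exact/flag_of_subP.
Qed.

Lemma flag_of_mul_eq h g j : h \in unitmx -> g \in unitmx ->
  (forall k l, (l < j)%N -> (j <= k)%N -> g k l = 0) ->
  flag_of (h *m g) j = flag_of h j.
Proof.
move=> hu gu H; apply/eqP; rewrite eqEdim !dim_flag_of ?unitmx_mul ?hu //.
by rewrite leqnn flag_of_mul.
Qed.

Lemma flag_of_borel h b : h \in unitmx -> borel F n b ->
  flag_of (h *m b) = flag_of h.
Proof.
move=> hu [bu b0]; apply/ffunP=> j; apply: flag_of_mul_eq => // k l lj jk.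
by apply: b0; lia.
Qed.

(** Coordinates with respect to the columns of [h] detect the subspaces of its
    flag. *)
Lemma flag_coord0 h j v k : h \in unitmx -> v \in flag_of h j -> (j <= k)%N ->
  (invmx h *m v) k 0 = 0.
Proof.
move=> hu vj jk; pose f := linfun (mulmx (row k (invmx h)) : 'cV_n -> 'cV_1).
have /subvP/(_ v vj) : (flag_of h j <= lker f)%VS.
  apply/flag_of_subP => l lj; rewrite memv_ker lfunE /= -row_mul -col_mulmx mulVmx //.
  apply/eqP/rowP=> z; rewrite !mxE; case: eqP => // e.
  by move: jk; rewrite e leqNgt lj.
by rewrite memv_ker lfunE /= -row_mul => /eqP/rowP/(_ 0); rewrite !mxE.
Qed.

Lemma flag_transition h h' j k l : h \in unitmx ->
  flag_of h j = flag_of h' j -> (l < j)%N -> (j <= k)%N -> (invmx h *m h') k l = 0.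
Proof.
move=> hu e lj jk; have := col_in_flag h' lj; rewrite -e => /(flag_coord0 hu)/(_ jk).
by rewrite -col_mulmx mxE.
Qed.

Lemma flag_step (U W : {vspace 'cV[F]_n}) v :
  (U <= W)%VS -> \dim W = (\dim U).+1 -> v \in W -> v \notin U -> W = (U + <[v]>)%VS.
Proof.
move=> UW dW vW vU; apply/esym/eqP; rewrite eqEdim subv_add UW -memvE vW /= dW.
rewrite ltn_neqAle dimvS ?addvSl // andbT; apply: contra vU => /eqP e.
have : (U == U + <[v]>)%VS by rewrite eqEdim addvSl e leqnn.
by move/eqP->; apply: (subvP (addvSr _ _)); rewrite memv_line.
Qed.

(** The columns are chosen one by one in the successive differences of the flag. *)
Lemma flagP V : is_flag V -> exists2 h : 'M[F]_n, h \in unitmx & V = flag_of h.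
Proof.
move=> [dV mV].
have dif k : exists v, (v \in V (lift ord0 k)) && (v \notin V (widen_ord (leqnSn n) k)).
  have : ~~ (V (lift ord0 k) <= V (widen_ord (leqnSn n) k))%VS.
    by apply/negP=> /dimvS; rewrite !dV /= /bump; lia.
  by case/subvPn=> v v1 v2; exists v; rewrite v1.
pose h := \matrix_(i, k) (xchoose (dif k)) i 0.
have hk k : col k h = xchoose (dif k) by apply/colP=> i; rewrite !mxE.
have hV j : (flag_of h j <= V j)%VS.
  apply/flag_of_subP => k kj; rewrite hk; have /andP [v1 _] := xchooseP (dif k).
  by apply: (subvP (mV _ _ _)) v1.
have Vh : forall m (mn : (m < n.+1)%N), (V (Ordinal mn) <= flag_of h (Ordinal mn))%VS.
  elim=> [|m IH] mn.
    by have /eqP := dV (Ordinal mn); rewrite dimv_eq0 => /eqP ->; apply: sub0v.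
  have mn' : (m < n)%N by []; pose k := Ordinal mn'.
  have e1 : lift ord0 k = Ordinal mn by apply/val_inj.
  have e2 : widen_ord (leqnSn n) k = Ordinal (ltnW mn) by apply/val_inj.
  have /andP [v1 v2] := xchooseP (dif k); rewrite -hk e1 e2 in v1 v2.
  rewrite (flag_step (mV (Ordinal (ltnW mn)) (Ordinal mn) _) _ v1 v2) ?dV //=.
  rewrite subv_add (subv_trans (IH _)) /= ?flag_of_mono //=.
  by rewrite -memvE col_in_flag.
have Vh' : V = flag_of h.
  apply/ffunP=> j; apply/eqP; rewrite eqEsubv hV andbT.
  by case: j => m mn; apply: Vh.
exists h => //; rewrite -row_free_unit -kermx_eq0; apply/eqP/row_matrixP=> i.
rewrite row0; set u := row i _.
have uh : u *m h = 0 by rewrite -row_mul mulmx_ker row0.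
pose f := linfun (mulmx u : 'cV_n -> 'cV_1).
(* The columns span, so a row vector that annihilates them is zero. *)
have fV : (fullv <= lker f)%VS.
  have -> : fullv = V ord_max.
    by apply/esym/eqP; rewrite eqEdim subvf dV dimvf /dim /= muln1 leqnn.
  rewrite Vh'; apply/flag_of_subP => k _.
  by rewrite memv_ker lfunE /= -col_mulmx uh col0.
apply/rowP=> k; have := subvP fV (delta_mx k 0) (memvf _).
by rewrite memv_ker lfunE /= -colE => /eqP/colP/(_ 0); rewrite !mxE.
Qed.

End OneSize.
End Flags.

(** * The operation P_i on matrices *)

Section Insert.
Variables (F : fieldType) (n : nat).
Implicit Types (A : 'M[F]_n) (p q : 'I_n.+1).

(** The matrix counterpart of [lift_perm]. *)
Definition insert_mx p q A : 'M[F]_n.+1 :=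
  \matrix_(k, l) match unlift p k, unlift q l with
                 | Some k', Some l' => A k' l'
                 | None, None => 1
                 | _, _ => 0
                 end.

Lemma insert_mx_lift p q A k l : insert_mx p q A (lift p k) (lift q l) = A k l.
Proof. by rewrite mxE !liftK. Qed.

Lemma insert_mx_row p q A l : insert_mx p q A p (lift q l) = 0.
Proof. by rewrite mxE unlift_none liftK. Qed.

Lemma insert_mx_col p q A k : insert_mx p q A (lift p k) q = 0.
Proof. by rewrite mxE unlift_none liftK. Qed.

Lemma insert_mx_one p q A : insert_mx p q A p q = 1.
Proof. by rewrite mxE !unlift_none. Qed.

Lemma insert_mxK p q A : row' p (col' q (insert_mx p q A)) = A.
Proof. by apply/matrixP=> k l; rewrite 2!mxE insert_mx_lift. Qed.

Lemma unitmx_insert p q A : A \in unitmx -> insert_mx p q A \in unitmx.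
Proof.
rewrite !unitmxE (expand_det_row _ p) (bigD1 q) //= big1 ?addr0 => [|l].
  by rewrite insert_mx_one mul1r /cofactor insert_mxK unitrM unitrX ?unitrN1.
by case: (unliftP q l) => [l' ->|->]; rewrite ?eqxx // insert_mx_row mul0r.
Qed.

Lemma col_insert_lift p q A l :
  col (lift q l) (insert_mx p q A) = ins0 F p (col l A).
Proof.
apply/colP=> k; rewrite mxE; case: (unliftP p k) => [k' ->|->].
  by rewrite insert_mx_lift ins0_lift mxE.
by rewrite insert_mx_row ins0_diag.
Qed.

Lemma col_insert p q A : col q (insert_mx p q A) = basis_vec F p.
Proof.
apply/colP=> k; rewrite mxE; case: (unliftP p k) => [k' ->|->].
  by rewrite insert_mx_col !mxE eq_sym (negbTE (neq_lift _ _)).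
by rewrite insert_mx_one !mxE !eqxx.
Qed.

End Insert.

Section PinsMatrix.
Variables (F : fieldType) (n : nat).
Implicit Types (A : 'M[F]_n) (i : 'I_n) (G : subspaces F n.+1).

Lemma unlift_highP i (k : 'I_n.+1) : k != high i ->
  exists2 k' : 'I_n, k = lift (high i) k' &
    ((k <= i)%N -> k' = k :> nat) /\ ((i < k)%N -> k' = k.-1 :> nat).
Proof.
case: (unliftP (high i) k) => [k' ->|->]; last by rewrite eqxx.
by exists k' => //; rewrite /= /bump; lia.
Qed.

Lemma ins0_flag_low A i (j : 'I_n.+2) : (j < i.+1)%N ->
  (ins0 F (low i) @: flag_of A (inord j))%VS = flag_of (insert_mx (low i) (high i) A) j.
Proof.
move=> ji; have jn : (inord j : 'I_n.+1) = j :> nat by rewrite inordK //; have := ltn_ord i; lia.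
apply/eqP; rewrite eqEsubv; apply/andP; split.
  apply/subvP=> _ /memv_imgP [u + ->]; rewrite memv_preim; apply/subvP.
  apply/flag_of_subP => k; rewrite jn => kj; rewrite -memv_preim.
  rewrite -(col_insert_lift _ (high i)); apply: col_in_flag; rewrite /= /bump; lia.
apply/flag_of_subP => k kj.
have [|k' ke [kk _]] := @unlift_highP i k.
  by rewrite -(inj_eq val_inj) /= /bump; lia.
by rewrite ke col_insert_lift memv_img // col_in_flag // jn; lia.
Qed.

Lemma ins0_flag_high A i (j : 'I_n.+2) : (i.+1 < j)%N ->
  (ins0 F (low i) @: flag_of A (inord j.-1) + <[basis_vec F (low i)]>)%VS =
  flag_of (insert_mx (low i) (high i) A) j.
Proof.
move=> ij; have jn : (inord j.-1 : 'I_n.+1) = j.-1 :> nat.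
  by rewrite inordK //; have := ltn_ord j; lia.
apply/eqP; rewrite eqEsubv; apply/andP; split.
  rewrite subv_add; apply/andP; split; last first.
    by rewrite -memvE -(col_insert _ (high i) A) col_in_flag.
  apply/subvP=> _ /memv_imgP [u + ->]; rewrite memv_preim; apply/subvP.
  apply/flag_of_subP => k; rewrite jn => kj; rewrite -memv_preim.
  rewrite -(col_insert_lift _ (high i)); apply: col_in_flag; rewrite /= /bump; lia.
apply/flag_of_subP => k kj; have [->|] := eqVneq k (high i).
  by rewrite col_insert; apply: (subvP (addvSr _ _)); rewrite memv_line.
case/unlift_highP => k' ke kk; rewrite ke col_insert_lift.
by apply: (subvP (addvSl _ _)); rewrite memv_img // col_in_flag // jn; lia.
Qed.

Lemma flag_insert_eq A A' i (j : 'I_n.+2) : flag_of A = flag_of A' -> j != i.+1 :> nat ->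
  flag_of (insert_mx (low i) (high i) A) j = flag_of (insert_mx (low i) (high i) A') j.
Proof.
move=> e; case: (ltngtP j i.+1) => // ji _.
  by rewrite -!ins0_flag_low // e.
by rewrite -!ins0_flag_high // e.
Qed.

(** Inserting the column e_i after the columns 0, ..., i turns both conditions in
    the definition of [Pins] into one: agreement with the flag of a matrix in all
    dimensions but one. *)
Lemma PinsP i (Z : set (subspaces F n)) G : Z `<=` @Fl F n ->
  Pins i Z G <-> is_flag G /\ exists A, [/\ A \in unitmx, Z (flag_of A) &
    forall j : 'I_n.+2, j != i.+1 :> nat ->
      G j = flag_of (insert_mx (low i) (high i) A) j].
Proof.
move=> ZF; split=> [[Gf [V [ZV V1 V2]]]|[Gf [A [Au ZA HA]]]]; split=> //.
  have [A Au VA] := flagP (ZF _ ZV); exists A; split=> // [|j ji].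
    by rewrite -VA.
  case: (ltngtP j i.+1) ji => // ji _.
    by rewrite V1 // VA ins0_flag_low.
  by rewrite V2 // VA ins0_flag_high.
exists (flag_of A); split=> // j ji; rewrite HA ?ins0_flag_low ?ins0_flag_high //; lia.
Qed.

End PinsMatrix.

(** * Flags that differ in one subspace *)

Section Shear.
Variables (F : fieldType) (n : nat).
Implicit Types (A : 'M[F]_n) (h : 'M[F]_n.+1) (i : 'I_n) (G : subspaces F n.+1) (c : F).

(** Adds [c] times column [high i] to column [low i]: the affine part of the
    projective line of flags that differ from the flag of [h] only in dimension
    i + 1. *)
Definition shear i c h := h *m (1%:M + c *: delta_mx (high i) (low i)).

Lemma shearE i c h k l :
  shear i c h k l = h k l + c * h k (high i) * (l == low i)%:R.
Proof.
rewrite /shear mulmxDr mulmx1 -scalemxAr !mxE; congr (_ + _).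
rewrite (bigD1 (high i)) //= big1 ?addr0 => [|j jh].
  by rewrite mxE eqxx /= mulrA.
by rewrite mxE (negbTE jh) mulr0.
Qed.

Lemma low_high i : (low i < high i)%N. Proof. by rewrite /= /bump. Qed.

Lemma low_neq_high i : low i != high i.
Proof. by rewrite high_lift neq_lift. Qed.

Lemma unitmx_shear i c h : h \in unitmx -> shear i c h \in unitmx.
Proof.
move=> hu; rewrite unitmx_mul hu unitmxE det_trig ?big1 ?unitr1 // => [k _|].
  rewrite !mxE eqxx; case: eqP => [->|]; last by rewrite mulr0 addr0.
  by rewrite eq_sym (negbTE (low_neq_high i)) mulr0 addr0.
apply/is_trig_mxP=> k l kl; rewrite !mxE.
have /negbTE -> : k != l by rewrite -(inj_eq val_inj) /=; lia.
case: eqP kl => [->|]; case: eqP => [->|]; rewrite ?mulr0 ?addr0 //.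
by move=> h1; have := low_high i; lia.
Qed.

Lemma flag_shear i c h (j : 'I_n.+2) : h \in unitmx -> j != i.+1 :> nat ->
  flag_of (shear i c h) j = flag_of h j.
Proof.
move=> hu ji; apply/eqP; rewrite eqEdim !dim_flag_of ?unitmx_shear // leqnn andbT.
apply: flag_of_mul => k l lj jk; rewrite !mxE.
have /negbTE -> : k != l by rewrite -(inj_eq val_inj) /=; lia.
case: eqP jk => [->|]; case: eqP lj => [->|]; rewrite ?mulr0 ?addr0 //=.
by rewrite /bump; lia.
Qed.

Lemma flag_insert_low A i (j : 'I_n.+2) : A \in unitmx -> j != i.+1 :> nat ->
  flag_of (insert_mx (low i) (low i) A) j = flag_of (insert_mx (low i) (high i) A) j.
Proof.
move=> Au ji; apply: flag_of_eqP; rewrite ?unitmx_insert // => k.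
case: (unliftP (low i) k) => [k' ->|->] kj; last first.
  rewrite col_insert -(col_insert (low i) (high i) A) col_in_flag //.
  by move: kj; rewrite /= /bump; lia.
rewrite col_insert_lift -(col_insert_lift _ (high i)) col_in_flag //.
by move: kj; rewrite /= /bump; lia.
Qed.

Lemma flag_replace h h' G i : h \in unitmx -> h' \in unitmx -> is_flag G ->
  (forall j : 'I_n.+2, j != i.+1 :> nat -> G j = flag_of h j) ->
  (forall j : 'I_n.+2, j != i.+1 :> nat -> flag_of h' j = flag_of h j) ->
  col (low i) h' \in G (lift ord0 (low i)) -> G = flag_of h'.
Proof.
move=> hu hu' [dG mG] Gh h'h lG; apply/ffunP=> j.
have [ji|ji] := eqVneq (j : nat) i.+1; last by rewrite Gh // h'h.
have -> : j = lift ord0 (low i) by apply/val_inj; rewrite /= ji.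
apply/esym/eqP; rewrite eqEdim dG dim_flag_of // leqnn andbT.
apply/flag_of_subP=> k; rewrite /= /bump /= add1n ltnS leq_eqVlt => /orP [/eqP ki|ki].
  by have -> : k = low i by apply/val_inj.
have iG : (lift ord0 (low i) : 'I_n.+2) = i.+1 :> nat by rewrite /= /bump.
apply: (subvP (mG (widen_ord (leqnSn _) (low i)) _ _)); first by rewrite iG /=.
by rewrite Gh -?h'h ?col_in_flag //=; lia.
Qed.

(** The subspaces of dimension i and i + 2 of [G] are known, and a vector of the one
    in between, modulo the smaller one, is a combination of the columns [low i]
    and [high i] of [h].  The two cases are the point at infinity and the affine
    points of a projective line. *)
Lemma flag_between h G i : h \in unitmx -> is_flag G ->
  (forall j : 'I_n.+2, j != i.+1 :> nat -> G j = flag_of h j) ->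
  col (high i) h \in G (lift ord0 (low i)) \/
  exists c, col (low i) h + c *: col (high i) h \in G (lift ord0 (low i)).
Proof.
move=> hu [dG mG] Gh; set J := lift ord0 (low i).
have JE : J = i.+1 :> nat by rewrite /J /= /bump.
pose I : 'I_n.+2 := widen_ord (leqnSn _) (low i).
pose K : 'I_n.+2 := lift ord0 (high i).
have KE : K = i.+2 :> nat by rewrite /K /= /bump.
have IJ : (G I <= G J)%VS by apply: mG; rewrite JE /=.
have JK : (G J <= G K)%VS by apply: mG; rewrite JE KE.
have /subvPn [v vJ vI] : ~~ (G J <= G I)%VS.
  by apply/negP=> /dimvS; rewrite !dG JE /= ltnn.
have vK : v \in flag_of h K by rewrite -Gh ?KE; [apply: (subvP JK)|lia].
set a := invmx h *m v.
have vE : v = \sum_k a k 0 *: col k h.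
  rewrite -[LHS](mulKVmx hu) -/a; apply/colP=> x; rewrite mxE summxE.
  by apply: eq_bigr => k _; rewrite !mxE mulrC.
pose r := \sum_(k | (k != low i) && (k != high i)) a k 0 *: col k h.
have vr : v = a (low i) 0 *: col (low i) h + (a (high i) 0 *: col (high i) h + r).
  rewrite {1}vE (bigD1 (low i)) //= (bigD1 (high i)) //= 1?eq_sym.
  by rewrite low_neq_high.
have rI : r \in G I.
  apply: rpred_sum => k /andP [kl kh]; have [ki|ik] := ltnP k i.
    by rewrite Gh ?rpredZ ?col_in_flag //=; lia.
  rewrite (flag_coord0 hu vK) ?scale0r ?rpred0 // KE.
  by move: kl kh; rewrite -!(inj_eq val_inj) /= /bump; lia.
have uJ : a (low i) 0 *: col (low i) h + a (high i) 0 *: col (high i) h \in G J.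
  by move: vJ; rewrite vr addrA rpredDr // (subvP IJ).
have [al|al] := eqVneq (a (low i) 0) 0.
  left; move: uJ; rewrite al scale0r add0r.
  have [ah|ah] := eqVneq (a (high i) 0) 0; last by rewrite rpredZeq (negbTE ah).
  by case/negP: vI; rewrite vr al ah !scale0r !add0r.
right; exists (a (high i) 0 / a (low i) 0).
have -> : col (low i) h + (a (high i) 0 / a (low i) 0) *: col (high i) h =
  (a (low i) 0)^-1 *: (a (low i) 0 *: col (low i) h + a (high i) 0 *: col (high i) h).
  by rewrite scalerDr !scalerA mulVf // scale1r mulrC.
by rewrite rpredZ.
Qed.

End Shear.

(** * The quasisymmetric flag variety as a union of cells *)

Section Cells.
Variables (F : fieldType).

Section MNC.
Variable n : nat.
Implicit Types (A : 'M[F]_n) (w : 'S_n).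

Lemma perm_onto w (x : 'I_n) : exists y, x = w y.
Proof. by exists (w^-1 x)%g; rewrite permKV. Qed.

Lemma unitmx_permutation w : permutation_matrix F w \in unitmx.
Proof.
have -> : permutation_matrix F w = (perm_mx w)^T.
  by apply/matrixP=> i j; rewrite !mxE eq_sym.
by rewrite unitmx_tr unitmx_perm.
Qed.

Lemma borel1 : borel F n 1%:M.
Proof.
split=> [|i j ji]; first exact: unitmx1.
by rewrite mxE; case: eqP ji => // ->; rewrite ltnn.
Qed.

(** A free entry in column i stands in a row w j < w i, above the entry 1 of this
    column; permuting the columns by w makes the matrix unitriangular. *)
Lemma MNC_borel w A : MNC F w A -> exists2 b, borel F n b & A = b *m permutation_matrix F w.
Proof.
move=> [A1 A0]; pose b := \matrix_(x, y) A x (w^-1 y)%g.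
have bb (x y : 'I_n) : (y <= x)%N -> b x y = (x == y)%:R.
  rewrite mxE => yx; have [e|ne] := eqVneq x y; first by rewrite e -{1}[y](permKV w) A1.
  rewrite -[x](permKV w) A0 ?(inj_eq perm_inj) 1?eq_sym //.
  by apply/negP=> /InvNCP [_]; rewrite !permKV; lia.
have Ab : A = b *m permutation_matrix F w.
  apply/matrixP=> x y; rewrite mxE (bigD1 (w y)) //= big1 ?addr0 => [|z zw].
    by rewrite !mxE eqxx mulr1 permK.
  by rewrite !mxE (negbTE zw) mulr0.
clearbody b; exists b => //; split=> [|x y yx]; last first.
  by rewrite bb 1?ltnW //; case: eqP yx => // ->; rewrite ltnn.
rewrite -unitmx_tr unitmxE det_trig ?big1 ?unitr1 // => [x _|].
  by rewrite mxE bb // eqxx.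
apply/is_trig_mxP=> x y xy; rewrite mxE bb 1?ltnW //; case: eqP xy => // ->.
by rewrite ltnn.
Qed.

Lemma unitmx_MNC w A : MNC F w A -> A \in unitmx.
Proof. by case/MNC_borel=> b [bu _] ->; rewrite unitmx_mul bu unitmx_permutation. Qed.

Lemma MNC_cell w : MNCB F w `<=` bruhat_cell F w.
Proof.
move=> _ [A /MNC_borel [b bb ->] <-]; exists b, 1%:M.
by split; rewrite ?mulmx1 //; exact: borel1.
Qed.

Lemma MNC_descent_col w A i x : MNC F w A -> (w i < i)%N -> A x i = (x == w i)%:R.
Proof.
move=> [A1 A0] wi; have [->|xi] := eqVneq x (w i); first exact: A1.
have [l xl] := perm_onto w x; rewrite xl in xi *.
apply: A0; first by move: xi; rewrite (inj_eq perm_inj) eq_sym.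
by apply/negP=> /InvNC_ascent; lia.
Qed.

Lemma MNC1 A : MNC F 1%g A -> A = 1%:M.
Proof.
move=> [A1 A0]; apply/matrixP=> x y; rewrite mxE.
have [->|xy] := eqVneq x y; first by have := A1 y; rewrite perm1.
have := A0 y x; rewrite perm1; apply; first by rewrite eq_sym.
by apply/negP=> /InvNCP [yx]; rewrite !perm1; lia.
Qed.

End MNC.

Section Step.
Variable n : nat.
Implicit Types (A : 'M[F]_n) (w : 'S_n) (i : 'I_n) (c : F).

(** The entry [c] is the one that the pair ([low i], [high i]) makes free; this pair
    is an inversion of [add_below w i] when [i <= w i], and of [add_point w i] when
    [w i < i]. *)
Lemma MNC_add_below w A i c : w \in NC n -> MNC F w A -> (i <= w i)%N || (c == 0) ->
  MNC F (add_below w i) (shear i c (insert_mx (low i) (high i) A)).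
Proof.
move=> wNC [A1 A0] ic; split=> [k|k l kl nInv]; rewrite shearE.
  case: (unliftP (high i) k) => [k' ->|->].
    by rewrite add_below_lift insert_mx_lift A1 insert_mx_col mulr0 mul0r addr0.
  by rewrite add_below_high !insert_mx_one eq_sym (negbTE (low_neq_high i)) mulr0 addr0.
case: (unliftP (high i) l) kl nInv => [l' ->|->].
  rewrite add_below_lift insert_mx_col mulr0 mul0r addr0.
  case: (unliftP (high i) k) => [k' ->|->]; last by rewrite insert_mx_col.
  by rewrite (inj_eq lift_inj) InvNC_add_below insert_mx_lift; apply: A0.
rewrite add_below_high insert_mx_one mulr1.
case: (unliftP (high i) k) => [k' ->|->]; last by rewrite eqxx.
rewrite insert_mx_row add0r => _.
have [->|] := eqVneq (lift (high i) k') (low i); last by rewrite mulr0.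
case/orP: ic => [iw|/eqP -> _]; last by rewrite mul0r.
case/negP; apply/InvNCP; rewrite rtransp_add_below NC_add_point add_below_high add_below_low.
by split=> //; rewrite /= /bump; lia.
Qed.

Lemma MNC_add_point w A i c : w \in NC n -> MNC F w A -> (w i < i)%N || (c == 0) ->
  MNC F (add_point w i) (shear i c (insert_mx (low i) (low i) A)).
Proof.
move=> wNC MA ic; have [A1 A0] := MA.
split=> [k|k l kl nInv]; rewrite shearE.
  rewrite high_lift; case: (unliftP (low i) k) => [k' ->|->].
    rewrite add_point_lift insert_mx_lift A1.
    by rewrite eq_sym (negbTE (neq_lift _ _)) mulr0 addr0.
  by rewrite add_point_low insert_mx_one insert_mx_row mulr0 mul0r addr0.
case: (unliftP (low i) k) kl nInv => [k' ->|->]; last first.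
  move=> nl nInv; rewrite eqxx mulr1.
  case: (unliftP (low i) l) nl nInv => [l' ->|->]; last by rewrite eqxx.
  move=> _; rewrite add_point_lift insert_mx_col add0r.
  rewrite [in insert_mx _ _ _ _ _]high_lift insert_mx_lift.
  case/orP: ic => [wi|/eqP ->]; last by rewrite mul0r.
  rewrite (MNC_descent_col _ MA wi).
  have [/perm_inj ->|] := eqVneq (w l') (w i); last by rewrite mulr0.
  rewrite -high_lift => /negP []; apply/InvNCP.
  rewrite rtransp_add_point NC_add_below add_point_high add_point_low.
  by split=> //; rewrite /= /bump; lia.
rewrite [_ == low i]eq_sym (negbTE (neq_lift _ _)) mulr0 addr0.
case: (unliftP (low i) l) => [l' ->|->].
  by rewrite (inj_eq lift_inj) InvNC_add_point add_point_lift insert_mx_lift; apply: A0.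
by rewrite add_point_low insert_mx_row.
Qed.

(** The converse of [MNC_add_below].  The hypothesis [i <= w i] is what keeps the
    row [low i] free of further entries; without it the column of the minimum of
    the block of [high i] may have one there. *)
Lemma MNC_below_inv w (A' : 'M[F]_n.+1) i : (i <= w i)%N -> MNC F (add_below w i) A' ->
  exists A c, MNC F w A /\ A' = shear i c (insert_mx (low i) (high i) A).
Proof.
move=> wi [A1 A0]; exists (row' (low i) (col' (high i) A')), (A' (low i) (low i)).
split; first split=> [k|k l kl nInv].
- by rewrite 2!mxE -add_below_lift A1.
- by rewrite 2!mxE -add_below_lift A0 ?(inj_eq lift_inj) ?InvNC_add_below.
apply/matrixP=> x y; rewrite shearE.
case: (unliftP (high i) y) => [l ->|->].
  case: (unliftP (low i) x) => [k ->|->].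
    by rewrite insert_mx_col mulr0 mul0r addr0 insert_mx_lift !mxE.
  rewrite insert_mx_row insert_mx_one mulr1 add0r.
  have [->|ll] := eqVneq; first by rewrite mulr1.
  rewrite mulr0 -{1}(add_below_high w i) A0 1?eq_sym ?neq_lift //.
  apply: contra ll => /add_below_row -> //.
  by rewrite add_below_low /= /bump; lia.
rewrite eq_sym (negbTE (low_neq_high i)) mulr0 addr0.
case: (unliftP (low i) x) => [k ->|->]; last first.
  by rewrite insert_mx_one -{1}(add_below_high w i) A1.
rewrite insert_mx_col; have [l kl] := perm_onto w k.
rewrite kl -add_below_lift A0 ?neq_lift //; apply/negP=> /InvNC_ascent.
by rewrite add_below_high leqNgt low_high.
Qed.

Lemma MNC_point_inv w (A' : 'M[F]_n.+1) i : (w i < i)%N -> MNC F (add_point w i) A' ->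
  exists A c, MNC F w A /\ A' = shear i c (insert_mx (low i) (low i) A).
Proof.
move=> wi [A1 A0].
have MA : MNC F w (row' (low i) (col' (low i) A')).
  split=> [k|k l kl nInv].
    by rewrite 2!mxE -add_point_lift A1.
  by rewrite 2!mxE -add_point_lift A0 ?(inj_eq lift_inj) ?InvNC_add_point.
exists (row' (low i) (col' (low i) A')), (A' (lift (low i) (w i)) (low i)).
split=> //; apply/matrixP=> x y; rewrite shearE high_lift.
case: (unliftP (low i) y) => [l ->|->].
  rewrite [_ == low i]eq_sym (negbTE (neq_lift _ _)) mulr0 addr0.
  case: (unliftP (low i) x) => [k ->|->]; first by rewrite insert_mx_lift !mxE.
  rewrite insert_mx_row -{1}(add_point_low w i) A0 1?eq_sym ?neq_lift //.
  exact: add_point_row.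
rewrite eqxx mulr1.
case: (unliftP (low i) x) => [k ->|->]; last first.
  by rewrite insert_mx_one insert_mx_row mulr0 addr0 -{1}(add_point_low w i) A1.
rewrite insert_mx_col insert_mx_lift add0r (MNC_descent_col _ MA wi).
have [->|ki] := eqVneq k (w i); first by rewrite mulr1.
have [l kl] := perm_onto w k; rewrite kl in ki *.
rewrite mulr0 -add_point_lift A0 ?neq_lift //.
apply: contra ki => /add_point_col; rewrite high_lift => H.
rewrite (@lift_inj _ _ _ _ (H _)) //.
by rewrite -high_lift add_point_high /= /bump; lia.
Qed.

Lemma col_shear i c (h : 'M[F]_n.+1) :
  col (low i) (shear i c h) = col (low i) h + c *: col (high i) h.
Proof.
by apply/colP=> x; rewrite [LHS]mxE shearE eqxx mulr1 [RHS]mxE; congr (_ + _); rewrite !mxE.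
Qed.

(** The point at infinity belongs to [add_point w i].  The affine point [c]
    belongs to [add_below w i] if [i <= w i] or [c = 0].  Otherwise column i of [A]
    is a basis vector e, and the span of e + c e_i is that of e_i + c^-1 e, the
    point [c^-1] seen from the matrix where the two columns are exchanged: it
    belongs to [add_point w i]. *)
Lemma Pins_MNC w A i G : w \in NC n -> MNC F w A -> is_flag G ->
  (forall j : 'I_n.+2, j != i.+1 :> nat ->
      G j = flag_of (insert_mx (low i) (high i) A) j) ->
  exists2 v, v \in NC n.+1 & MNCB F v G.
Proof.
move=> wNC MA Gf GA; have Au := unitmx_MNC MA.
have hu := unitmx_insert (low i) (high i) Au.
have lu := unitmx_insert (low i) (low i) Au.
have agree c (j : 'I_n.+2) : j != i.+1 :> nat ->
    flag_of (shear i c (insert_mx (low i) (low i) A)) j =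
    flag_of (insert_mx (low i) (high i) A) j.
  by move=> ji; rewrite flag_shear // flag_insert_low.
have col_E c : col (low i) (shear i c (insert_mx (low i) (low i) A)) =
    basis_vec F (low i) + c *: ins0 F (low i) (col i A).
  rewrite -(col_insert (low i) (low i) A) -(col_insert_lift _ (low i)) -high_lift.
  exact: col_shear.
have [|[c]] := flag_between hu Gf GA.
  rewrite col_insert => eG; exists (add_point w i); first by rewrite NC_add_point.
  exists (shear i 0 (insert_mx (low i) (low i) A)).
    by apply: MNC_add_point => //; rewrite eqxx orbT.
  apply/esym/(flag_replace hu _ Gf GA); rewrite ?unitmx_shear //; first exact: agree.
  by rewrite col_E scale0r addr0.
rewrite {1}low_lift col_insert_lift col_insert => cG.
have [ic|] := boolP ((i <= w i)%N || (c == 0)).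
  exists (add_below w i); first by rewrite NC_add_below.
  exists (shear i c (insert_mx (low i) (high i) A)); first exact: MNC_add_below.
  apply/esym/(flag_replace hu _ Gf GA); rewrite ?unitmx_shear //.
    by move=> j ji; rewrite flag_shear.
  by rewrite col_shear col_insert {1}low_lift col_insert_lift.
rewrite negb_or -ltnNge => /andP [wi c0].
exists (add_point w i); first by rewrite NC_add_point.
exists (shear i c^-1 (insert_mx (low i) (low i) A)).
  by apply: MNC_add_point => //; rewrite wi.
apply/esym/(flag_replace hu _ Gf GA); rewrite ?unitmx_shear //; first exact: agree.
rewrite col_E -[X in X + _]scale1r -(mulVf c0) -scalerA -scalerDr addrC.
by rewrite rpredZ.
Qed.

(** By [NC_growth], the rows and columns of a matrix in the cell can be removed
    by the inverse of one of the two moves; for the identity the cell is a point,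
    the standard flag. *)
Lemma MNC_Pins v : v \in NC n.+1 -> (0 < n)%N -> forall A' : 'M[F]_n.+1, MNC F v A' ->
  exists w A i, [/\ w \in NC n, MNC F w A & forall j : 'I_n.+2, j != i.+1 :> nat ->
      flag_of A' j = flag_of (insert_mx (low i) (high i) A) j].
Proof.
move=> /NC_growth [->|[w [i [wNC [[-> wi]|[-> wi]]]]]] n0 A' MA'.
- pose i := Ordinal n0; exists 1%g, 1%:M, i; split=> [||j ji].
  + by apply/NC_stableP=> x y; rewrite !perm1; lia.
  + split=> [k|k l kl]; rewrite perm1 mxE ?eqxx // => _.
    by rewrite eq_sym (negbTE kl).
  rewrite (MNC1 MA') -flag_insert_low ?unitmx1 //; congr (flag_of _ j).
  apply/matrixP=> x y; case: (unliftP (low i) x) (unliftP (low i) y) => [x' ->|->] [y' ->|->];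
    rewrite ?insert_mx_lift ?insert_mx_col ?insert_mx_row ?insert_mx_one;
    by rewrite !mxE ?(inj_eq lift_inj) ?eqxx.
- have [A [c [MA ->]]] := MNC_below_inv wi MA'; exists w, A, i; split=> // j ji.
  by rewrite flag_shear // unitmx_insert // (unitmx_MNC MA).
- have [A [c [MA ->]]] := MNC_point_inv wi MA'; exists w, A, i; split=> // j ji.
  by rewrite flag_shear ?flag_insert_low // ?unitmx_insert // (unitmx_MNC MA).
Qed.

End Step.
End Cells.

Section QFl.
Variable F : fieldType.

Lemma Pseq_eq (i i' : forall j, 'I_j.+1) m :
  (forall j, (j < m)%N -> i j = i' j) -> @Pseq F i m = @Pseq F i' m.
Proof.
elim: m => //= m IH H; rewrite H // IH // => j jm; apply: H; exact: ltnW.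
Qed.

(** The last index of a sequence can be chosen independently of the others. *)
Lemma QFl_step m G :
  QFl F m.+2 G <-> exists i : 'I_m.+1, Pins i (QFl F m.+1) G.
Proof.
split=> [[i _ /= [Gf [V [ZV V1 V2]]]]|[c [Gf [V [[i _ ZV] V1 V2]]]]].
  by exists (i m); split=> //; exists V; split=> //; exists i.
pose i' j := if j =P m is ReflectT e then ecast k 'I_k.+1 (esym e) c else i j.
have im : i' m = c by rewrite /i'; case: eqP => // e; rewrite (eq_axiomK e).
exists i' => //=; rewrite im; split=> //; exists V; split=> //.
rewrite (@Pseq_eq _ i m) // => j jm; rewrite /i'; case: eqP => // e.
by exfalso; rewrite e ltnn in jm.
Qed.

Lemma QFl_sub n : QFl F n `<=` @Fl F n.
Proof. by case: n => [|[|n]] G // [i _] //= []. Qed.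

Lemma MNCB_flag n w : MNCB F w `<=` @Fl F n.
Proof. by move=> _ [A /unitmx_MNC Au <-]; apply: flag_of_is_flag. Qed.

Lemma QFlP n G : (0 < n)%N -> QFl F n G <-> exists2 w : 'S_n, w \in NC n & MNCB F w G.
Proof.
case: n G => // n G _; elim: n G => [|m IH] G.
  split=> [[i _ /= Gf]|[w _ /MNCB_flag GF]]; last first.
    by exists (fun j => ord0).
  have [h hu ->] := flagP Gf; exists 1%g.
    by apply/NC_stableP=> x y; rewrite !perm1; lia.
  exists 1%:M; first split=> [k|k l].
  - by rewrite perm1 mxE eqxx.
  - by rewrite (ord1 k) (ord1 l) eqxx.
  rewrite -[h in RHS]mul1mx flag_of_borel ?unitmx1 //; split=> // x y.
  by rewrite !ord1.
split.
  case/QFl_step=> i /PinsP [|Gf [A [Au ZA HA]]]; first exact: QFl_sub.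
  have [w wNC [B MB BA]] := (IH _).1 ZA.
  have [|v vNC Gv] := Pins_MNC wNC MB Gf (i := i); last by exists v.
  by move=> j ji; rewrite HA // (flag_insert_eq (esym BA)).
move=> [v vNC [A' MA' <-]]; have [//|w [A [i [wNC MA HA]]]] := MNC_Pins vNC _ MA'.
apply/QFl_step; exists i; apply/PinsP; first exact: QFl_sub.
split; first by apply/flag_of_is_flag/unitmx_MNC/MA'.
exists A; split=> //; first exact: unitmx_MNC MA.
by apply/IH; exists w => //; exists A.
Qed.

End QFl.

(** * Rank counts and the Bruhat order *)

Section Bruhat.
Variable n : nat.
Implicit Types (u v w : 'S_n) (i j k : 'I_n).

(** The rank of the lower left corner of the permutation matrix of [w] formed by
    the rows from [p] on and the columns before [q]. *)
Definition rank_count w (p q : nat) : nat := (\sum_(k : 'I_n | (k < q)%N) (p <= w k)%N)%N.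

Definition dominated v w : Prop := forall p q, (rank_count v p q <= rank_count w p q)%N.

(** Applying the transposition to a pair, whenever this keeps the pair increasing,
    is an involution of the increasing pairs.  It maps inversions of [v] to
    inversions of the product, and it fixes (i, j), which is an inversion of the
    product only. *)
Lemma card_Inv_rtransp v i j : (i < j)%N -> (v i < v j)%N ->
  (#|Inv v| < #|Inv (rtransp v i j)|)%N.
Proof.
move=> ij vij; set t := tperm i j.
pose f (x : 'I_n * 'I_n) := if (t x.1 < t x.2)%N then (t x.1, t x.2) else x.
have f_inj : {in Inv v &, injective f}.
  move=> [a b] [c d]; rewrite !inE /= => /andP [ab _] /andP [cd _]; rewrite /f /=.
  case: ltnP => h1; case: ltnP => h2 [e1 e2].
  - by rewrite (perm_inj e1) (perm_inj e2).
  - by move: h2; rewrite -e1 -e2 !tpermK leqNgt ab.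
  - by move: h1; rewrite e1 e2 !tpermK leqNgt cd.
  - by rewrite e1 e2.
rewrite -(card_in_imset f_inj); apply/proper_card/properP; split.
  apply/fintype.subsetP=> _ /imsetP [[a b] + ->]; rewrite !inE /= => /andP [ab vab].
  rewrite /f /=; have [h|h] := ltnP (t a) (t b) => /=;
    rewrite /rtransp !permM /= ?tpermK ?h ?vab ?ab //=.
  move: h; rewrite -/t.
  case: (tpermP i j a) => [ea|ea|/eqP ai /eqP aj]; case: (tpermP i j b) => [eb|eb|/eqP bi /eqP bj];
    rewrite ?ea ?eb in ab vab *; lia.
exists (i, j); first by rewrite !inE ij /= /rtransp !permM tpermL tpermR.
apply/negP=> /imsetP [[a b]]; rewrite !inE /= => /andP [ab vab]; rewrite /f /=.
case: ltnP => h [e1 e2].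
  by move: ab; rewrite -(tpermK i j a) -(tpermK i j b) -/t -e1 -e2 /t tpermL tpermR; lia.
by move: vab; rewrite -e1 -e2; lia.
Qed.

(** If [v i] were larger, [v] would have more entries than [w] in the corner from
    row [v i] on and up to column [i]. *)
Lemma dominated_first v w i : dominated v w ->
  (forall k, (k < i)%N -> v k = w k) -> v i != w i -> (v i < w i)%N.
Proof.
move=> vw eqvw ne; rewrite ltnNge; apply/negP=> wv.
have := vw (v i) i.+1; rewrite /rank_count [leqLHS](bigD1 i) //= [leqRHS](bigD1 i) //= leqnn.
rewrite [(v i <= w i)%N]leqNgt ltn_neqAle wv eq_sym ne /= add0n.
rewrite [X in (1 + X <= _)%N](eq_bigr (fun k => (v i <= w k)%N : nat)); first by rewrite ltnn.
move=> k /andP [ki kni]; rewrite (eqvw k) //.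
by move: kni; rewrite -(inj_eq val_inj) /=; lia.
Qed.

Lemma first_diff v w : v != w -> exists i, v i != w i /\ (forall k, (k < i)%N -> v k = w k).
Proof.
move=> ne; have [i0 Pi0] : exists i, v i != w i.
  apply/existsP; apply: contraNT ne => /existsPn H.
  by apply/eqP/permP=> k; apply/eqP; rewrite -[_ == _]negbK.
case: (@arg_minnP _ i0 (fun i => v i != w i) (fun i => i : nat) Pi0) => i Pi imin.
exists i; split=> // k ki; apply/eqP; rewrite -[_ == _]negbK; apply/negP=> /imin.
by rewrite leqNgt ki.
Qed.

Lemma dominated_anti v w : dominated v w -> dominated w v -> v = w.
Proof.
move=> vw wv; apply/eqP/negPn/negP => /first_diff [i [ne e]].
have := dominated_first vw e ne.
have := dominated_first wv (fun k ki => esym (e k ki)) _; rewrite eq_sym => /(_ ne).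
lia.
Qed.

(** Let [i] be the first column where [v] and [w] differ and [j] the first later
    column with [v i < v j <= w i].  The product has one more entry than [v]
    only in the corners with [i < q <= j] and [v i < p <= v j]; there [v] has
    strictly fewer entries than [w]: compare the rows after [w i] by domination,
    and the rows from [p] to [w i], which [v] meets only in columns before [i],
    directly. *)
Lemma dominated_step v w : dominated v w -> v != w -> exists i j,
  [/\ (i < j)%N, (v i < v j)%N & dominated (rtransp v i j) w].
Proof.
move=> vw /first_diff [i [ne e]]; have viw := dominated_first vw e ne.
pose P j := [&& (i < j)%N, (v i < v j)%N & (v j <= w i)%N].
have [j0 Pj0] : exists j, P j.
  exists (v^-1 (w i))%g; rewrite /P permKV viw leqnn !andbT.
  rewrite ltnNge leq_eqVlt negb_or; apply/andP; split.
    by apply: contra ne => /eqP/val_inj h; rewrite -{1}h permKV.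
  apply/negP=> ki; have := e _ ki; rewrite permKV => /perm_inj ek.
  by rewrite -ek ltnn in ki.
case: (@arg_minnP _ j0 P (fun i => i : nat) Pj0) => j /and3P [ij vij vjw] jmin.
exists i, j; split=> // p q.
have [qi|iq] := leqP q i.
  apply: leq_trans (vw p q); apply: leq_sum => k kq.
  by rewrite /rtransp permM tpermD // -(inj_eq val_inj) /=; lia.
have [qj|jq] := leqP q j; last first.
  apply: leq_trans (vw p q); rewrite /rank_count (reindex_inj (@perm_inj _ (tperm i j))) /=.
  rewrite (eq_bigl (fun k : 'I_n => (k < q)%N)).
    by apply: leq_sum => k _; rewrite /rtransp permM tpermK.
  by move=> k; case: tpermP => [->|->|]; lia.
rewrite /rank_count (bigD1 i) //= /rtransp permM tpermL.
rewrite (eq_bigr (fun k => (p <= v k)%N : nat)); last first.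
  move=> k /andP [kq ki]; rewrite /rtransp permM tpermD //; first by rewrite eq_sym.
  by rewrite -(inj_eq val_inj) /=; lia.
have [pv|pv] := boolP ((v i < p) && (p <= v j))%N; last first.
  by apply: leq_trans (vw p q); rewrite /rank_count [leqRHS](bigD1 i) //= leq_add2r; lia.
have := vw (w i).+1 q; rewrite /rank_count.
have split_sum u : (\sum_(k : 'I_n | (k < q)%N) (p <= u k)%N =
    \sum_(k : 'I_n | (k < q)%N) (w i < u k)%N + \sum_(k : 'I_n | (k < q)%N) (p <= u k <= w i)%N)%N.
  by rewrite -big_split /=; apply: eq_bigr => k _; lia.
rewrite (split_sum w).
have := split_sum v; rewrite (bigD1 i) //= leqNgt (andP pv).1 /= add0n => ->.
rewrite (andP pv).2 => H; rewrite addnCA; apply: leq_add => //.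
rewrite (bigD1 i) //= [X in (_ <= X)%N](bigD1 i) //= leqnn andbT.
have -> : (p <= v i <= w i)%N = false by lia.
rewrite add0n; apply: leq_add; first by lia.
apply: leq_sum => k /andP [kq]; rewrite -(inj_eq val_inj) /= => ki.
have [k_i|ik] := ltnP k i; first by rewrite e.
by have := jmin k; rewrite /P; lia.
Qed.

(** The steps of [dominated_step] end at [w], since each one raises the number of
    inversions. *)
Lemma dominated_bruhat v w : dominated v w -> bruhat v w.
Proof.
have [m] := ubnP (n * n - #|Inv v|)%N; elim: m v => // m IH v mv vw.
have [->|ne] := eqVneq v w; first exact: connect0.
have [i [j [ij vij dw]]] := dominated_step vw ne.
have lt := card_Inv_rtransp ij vij.
have : (#|Inv (rtransp v i j)| <= n * n)%N.
  by rewrite (leq_trans (max_card _)) // card_prod card_ord.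
move=> bd; apply: (@connect_trans _ _ (rtransp v i j)); last by apply: IH => //; lia.
apply: connect1 => /=; rewrite lt andbT; apply/existsP; exists i; apply/existsP; exists j.
by rewrite eqxx.
Qed.

End Bruhat.

(** * Ranks of lower left corners on Bruhat cells *)

Section Corner.
Variables (F : fieldType) (n : nat).
Implicit Types (h b : 'M[F]_n) (w : 'S_n).

Definition corner p q h : 'M[F]_n :=
  \matrix_(i, j) (if (p <= i)%N && (j < q)%N then h i j else 0).

Definition selection (P : pred 'I_n) : 'M[F]_n := diag_mx (\row_i (P i)%:R).

Lemma selectionM P h i j : (selection P *m h) i j = (P i)%:R * h i j.
Proof. by rewrite mul_diag_mx !mxE. Qed.

Lemma mulmx_selection P h i j : (h *m selection P) i j = h i j * (P j)%:R.
Proof. by rewrite mul_mx_diag !mxE. Qed.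

Lemma corner_selection p q h :
  corner p q h = selection (fun i => p <= i)%N *m h *m selection (fun j => j < q)%N.
Proof.
apply/matrixP=> i j; rewrite mulmx_selection selectionM mxE.
by case: (p <= i)%N; case: (j < q)%N; rewrite ?mul1r ?mul0r ?mulr1 ?mulr0.
Qed.

(** The projection and its complement have ranks bounded by the sizes of two
    complementary sets, and they add up to the identity. *)
Lemma mxrank_selection P : \rank (selection P) = #|[pred i | P i]|.
Proof.
have le Q : (\rank (selection Q) <= #|[pred i | Q i]|)%N.
  have -> : selection Q = \sum_(i | Q i) delta_mx i i.
    apply/matrixP=> i j; rewrite summxE mxE mxE.
    have [<-|ne] := eqVneq i j; last first.
      rewrite big1 // => k _; rewrite mxE; case: eqP => // <-.
      by rewrite eq_sym (negbTE ne).
    rewrite mulr1n big_mkcond (bigD1 i) //= big1 ?addr0 => [|k ki].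
      by case: (Q i); rewrite ?mxE ?eqxx.
    by case: (Q k); rewrite // mxE eq_sym (negbTE ki).
  rewrite -sum1_card; apply: (big_ind2 (fun A m => \rank A <= m)%N) => [|A m B k Am Bk|i _].
  - by rewrite mxrank0.
  - by rewrite (leq_trans (mxrank_add _ _)) // leq_add.
  by rewrite mxrank_delta.
apply/eqP; rewrite eqn_leq le /=.
have e : selection P + selection (predC P) = 1%:M.
  apply/matrixP=> i j; rewrite !mxE; case: (i == j); rewrite ?mulr1n ?mulr0n ?addr0 //=.
  by case: (P i); rewrite ?addr0 ?add0r.
have : (n <= \rank (selection P) + \rank (selection (predC P)))%N.
  by rewrite -[leqLHS](mxrank1 F) -e mxrank_add.
have c : (#|[pred i | P i]| + #|[pred i | predC P i]|)%N = n.
  by rewrite -[RHS]card_ord -(cardC [pred i | P i]); congr (_ + _)%N; apply: eq_card.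
by move=> H; rewrite -(leq_add2r #|[pred i | predC P i]|) c (leq_trans H) // leq_add2l le.
Qed.

Lemma mxrank_corner_permutation w p q :
  \rank (corner p q (permutation_matrix F w)) = rank_count w p q.
Proof.
have -> : corner p q (permutation_matrix F w) =
    permutation_matrix F w *m selection (fun y => (p <= w y)%N && (y < q)%N).
  apply/matrixP=> x y; rewrite mulmx_selection !mxE.
  case: eqP => [->|_]; last by rewrite mul0r if_same.
  by rewrite mul1r; case: (_ && _).
rewrite -mxrank_tr trmx_mul mxrankMfree; last first.
  by rewrite row_free_unit unitmx_tr unitmx_permutation.
rewrite mxrank_tr mxrank_selection /rank_count -sum1_card big_mkcond [RHS]big_mkcond.
by apply: eq_bigr => k _; rewrite inE; case: (p <= w k)%N; case: (k < q)%N.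
Qed.

Lemma borel_inv b : borel F n b -> borel F n (invmx b).
Proof.
move=> bB; have [bu _] := bB; split=> [|i j ji]; first by rewrite unitmx_inv.
have jn : (i < n.+1)%N by rewrite ltnW // ltnS.
have := @flag_transition F n b 1%:M (Ordinal jn) i j bu; rewrite mulmx1; apply=> //.
by rewrite -[b]mul1mx flag_of_borel // unitmx1.
Qed.

Lemma borel_quotient h h' : h \in unitmx -> h' \in unitmx -> flag_of h = flag_of h' ->
  borel F n (invmx h *m h').
Proof.
move=> hu hu' e; split=> [|i j ji]; first by rewrite unitmx_mul unitmx_inv hu.
have jn : (i < n.+1)%N by rewrite ltnW // ltnS.
by apply: (@flag_transition F n _ _ (Ordinal jn)) => //; rewrite e.
Qed.

(** Upper triangular row operations add lower rows to higher ones, and such column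
    operations add left columns to right ones, so the corner of the product is a
    product with the corner as a factor. *)
Lemma mxrank_corner_le b1 b2 p q h : borel F n b1 -> borel F n b2 ->
  (\rank (corner p q (b1 *m h *m b2)) <= \rank (corner p q h))%N.
Proof.
move=> [_ b10] [_ b20].
pose T := selection (fun i => p <= i)%N; pose S := selection (fun j => j < q)%N.
have Tb : T *m b1 = T *m b1 *m T.
  apply/matrixP=> i j; rewrite mulmx_selection !selectionM.
  have [pj|jp] := leqP p j; first by rewrite mulr1.
  rewrite mulr0; have [pi|ip] := leqP p i; last by rewrite mul0r.
  by rewrite b10 ?mulr0 //; lia.
have Sb : b2 *m S = S *m (b2 *m S).
  apply/matrixP=> i j; rewrite selectionM !mulmx_selection.
  have [iq|qi] := ltnP i q; first by rewrite mul1r.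
  rewrite mul0r; have [jq|qj] := ltnP j q; last by rewrite mulr0.
  by rewrite b20 ?mul0r //; lia.
rewrite !corner_selection -/T -/S.
have -> : T *m (b1 *m h *m b2) *m S = (T *m b1) *m (T *m h *m S) *m (b2 *m S).
  rewrite !mulmxA [in LHS]Tb -!mulmxA [in LHS]Sb !mulmxA //.
by rewrite (leq_trans (mxrankM_maxl _ _)) // mxrankM_maxr.
Qed.

Lemma mxrank_corner_borel b1 b2 p q h : borel F n b1 -> borel F n b2 ->
  \rank (corner p q (b1 *m h *m b2)) = \rank (corner p q h).
Proof.
move=> B1 B2; apply/eqP; rewrite eqn_leq mxrank_corner_le //=.
have := mxrank_corner_le p q (b1 *m h *m b2) (borel_inv B1) (borel_inv B2).
have [b1u _] := B1; have [b2u _] := B2.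
by rewrite -!mulmxA mulKmx // mulmxV // mulmx1.
Qed.

Lemma bruhat_cell_rank w h p q : h \in unitmx -> bruhat_cell F w (flag_of h) ->
  \rank (corner p q h) = rank_count w p q.
Proof.
move=> hu [b1 [b2 [B1 B2 e]]]; have [b1u _] := B1; have [b2u _] := B2.
set h' := _ *m b2 in e; have hu' : h' \in unitmx by rewrite !unitmx_mul b1u unitmx_permutation.
have E : h = 1%:M *m h' *m (invmx h' *m h) by rewrite mul1mx mulKVmx.
rewrite E mxrank_corner_borel; [|exact: borel1|exact: borel_quotient].
by rewrite mxrank_corner_borel // mxrank_corner_permutation.
Qed.

Lemma bruhat_cell_disjoint v w V : bruhat_cell F v V -> bruhat_cell F w V -> v = w.
Proof.
move=> vV wV; have [b1 [b2 [[b1u _] [b2u _] e]]] := vV; rewrite e in vV wV.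
have hu : b1 *m permutation_matrix F v *m b2 \in unitmx.
  by rewrite !unitmx_mul b1u unitmx_permutation.
have vw p q := bruhat_cell_rank p q hu vV; have wv p q := bruhat_cell_rank p q hu wV.
by apply: dominated_anti => p q; rewrite -vw -wv.
Qed.

End Corner.

(** * Closed subsets of the general linear group *)

Section Polynomial.
Variable F : fieldType.

Section OneSize.
Variable n : nat.
Implicit Types (f g : 'M[F]_n -> F).

Definition is_polynomial f : Prop :=
  exists p : mpoly.mpoly (n * n) F, forall h, mpoly.meval (fun k => mxvec h 0 k) p = f h.

Lemma polynomial_const c : is_polynomial (fun=> c).
Proof. by exists (mpoly.mpolyC _ c) => h; rewrite mpoly.mevalC. Qed.

Lemma polynomial_entry i j : is_polynomial (fun h => h i j).
Proof.
exists (mpoly.mpolyX _ (mpoly.mnm1 (mxvec_index i j))) => h.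
by rewrite mpoly.mevalXU mxvecE.
Qed.

Lemma polynomialM f g : is_polynomial f -> is_polynomial g -> is_polynomial (fun h => f h * g h).
Proof. by move=> [p Hp] [q Hq]; exists (p * q) => h; rewrite mpoly.mevalM Hp Hq. Qed.

Lemma polynomial_sum (I : Type) (r : seq I) (P : pred I) (f : I -> 'M[F]_n -> F) :
  (forall i, is_polynomial (f i)) -> is_polynomial (fun h => \sum_(i <- r | P i) f i h).
Proof.
move=> Hf; elim: r => [|i r [p Hp]].
  by exists 0 => h; rewrite big_nil mpoly.meval0.
have [q Hq] := Hf i; exists (if P i then q + p else p) => h.
by rewrite big_cons; case: (P i); rewrite ?mpoly.mevalD Hp // Hq.
Qed.

Lemma polynomial_prod (I : Type) (r : seq I) (P : pred I) (f : I -> 'M[F]_n -> F) :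
  (forall i, is_polynomial (f i)) -> is_polynomial (fun h => \prod_(i <- r | P i) f i h).
Proof.
move=> Hf; elim: r => [|i r [p Hp]].
  by exists 1 => h; rewrite big_nil mpoly.meval1.
have [q Hq] := Hf i; exists (if P i then q * p else p) => h.
by rewrite big_cons; case: (P i); rewrite ?mpoly.mevalM Hp // Hq.
Qed.

Lemma polynomial_det k (M : 'M[F]_n -> 'M[F]_k) :
  (forall i j, is_polynomial (fun h => M h i j)) -> is_polynomial (fun h => \det (M h)).
Proof.
move=> HM; apply: polynomial_sum => s; apply: polynomialM; first exact: polynomial_const.
by apply: polynomial_prod => i.
Qed.

End OneSize.

Lemma polynomial_comp n k (M : 'M[F]_n -> 'M[F]_k) (f : 'M[F]_k -> F) :
  (forall i j, is_polynomial (fun h => M h i j)) -> is_polynomial f ->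
  is_polynomial (fun h => f (M h)).
Proof.
move=> HM [p Hp].
have /boolp.choice [q Hq] : forall z : 'I_(k * k), exists q : mpoly.mpoly (n * n) F,
    forall h, mpoly.meval (fun y => mxvec h 0 y) q = mxvec (M h) 0 z.
  move=> z; case/mxvec_indexP: z => i j; have [q Hq] := HM i j.
  by exists q => h; rewrite Hq mxvecE.
exists (mpoly.comp_mpoly [tuple q z | z < k * k] p) => h.
rewrite mpoly.comp_mpoly_meval -Hp; apply: mpoly.meval_eq => z.
by rewrite tnth_mktuple Hq.
Qed.

Section Closed.
Variable n : nat.
Implicit Types (S : 'M[F]_n -> Prop).

(** Stated for conditions on matrices instead of sets of flags, so that the
    conjunctions, disjunctions and quantifiers that define a set of flags
    translate into closure properties. *)
Definition zclosed S : Prop :=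
  exists E : set ('M[F]_n -> F), (forall f, E f -> is_polynomial f) /\
    forall h, h \in unitmx -> (S h <-> forall f, E f -> f h = 0).

Lemma zclosed_ext S S' : (forall h, h \in unitmx -> (S h <-> S' h)) ->
  zclosed S -> zclosed S'.
Proof.
by move=> SS' [E [pE HE]]; exists E; split=> // h hu; rewrite -SS' ?HE.
Qed.

Lemma zclosed_zeros (I : Type) (P : I -> Prop) (f : I -> 'M[F]_n -> F) :
  (forall x, P x -> is_polynomial (f x)) -> zclosed (fun h => forall x, P x -> f x h = 0).
Proof.
move=> Hf; exists [set g | exists2 x, P x & g = f x]; split=> [_ [x Px ->]|h _]; first exact: Hf.
by split=> [H _ [x Px ->]|H x Px]; apply: H => //; exists x.
Qed.

Lemma zclosed_all (I : Type) (S : I -> 'M[F]_n -> Prop) :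
  (forall x, zclosed (S x)) -> zclosed (fun h => forall x, S x h).
Proof.
move=> /boolp.choice [E HE]; exists (\bigcup_x E x); split=> [f [x _ Ef]|h hu].
  exact: (HE x).1 Ef.
split=> [H f [x _ Ef]|H x]; first by apply: ((HE x).2 h hu).1 => //; exact: H.
by apply/((HE x).2 h hu) => f Ef; apply: H; exists x.
Qed.

Lemma zclosed_and S S' : zclosed S -> zclosed S' -> zclosed (fun h => S h /\ S' h).
Proof.
move=> cS cS'; apply: (@zclosed_ext (fun h => forall b : bool, (if b then S else S') h)).
  by move=> h _; split=> [H|[H H'] []//]; split; [exact: (H true)|exact: (H false)].
by apply: zclosed_all => -[].
Qed.

(** The union of two zero sets is the zero set of the pairwise products. *)
Lemma zclosed_or S S' : zclosed S -> zclosed S' -> zclosed (fun h => S h \/ S' h).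
Proof.
move=> [E [pE HE]] [E' [pE' HE']].
exists [set g | exists f f', [/\ E f, E' f' & g = fun h => f h * f' h]]; split.
  by move=> _ [f [f' [Ef Ef' ->]]]; apply: polynomialM; [exact: pE|exact: pE'].
move=> h hu; split=> [+ _ [f [f' [Ef Ef' ->]]]|H].
  case=> [/(HE h hu) H|/(HE' h hu) H]; first by rewrite (H f Ef) mul0r.
  by rewrite (H f' Ef') mulr0.
case: (pselect (S h)) => [|nS]; [by left|right].
have [f [Ef /eqP fh]] : exists f, E f /\ f h <> 0.
  apply: contrapT => nex; apply: nS; apply/(HE h hu) => f Ef.
  by apply: contrapT => fh; apply: nex; exists f.
apply/(HE' h hu) => f' Ef'; have /eqP := H _ (ex_intro _ f (ex_intro _ f' (And3 Ef Ef' erefl))).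
by rewrite mulf_eq0 (negbTE fh) => /eqP.
Qed.

Lemma zclosed_exists (T : finType) (S : T -> 'M[F]_n -> Prop) :
  (forall x, zclosed (S x)) -> zclosed (fun h => exists x, S x h).
Proof.
move=> cS; apply: (@zclosed_ext (fun h => exists2 x, x \in enum T & S x h)).
  move=> h _; split=> [[x _ Sx]|[x Sx]]; exists x => //; by rewrite mem_enum.
elim: (enum T) => [|x s IH].
  apply: (@zclosed_ext (fun h => forall x : unit, True -> (1 : F) = 0)).
    move=> h _; split=> [/(_ tt I)/eqP|[x] //]; by rewrite oner_eq0.
  by apply: (@zclosed_zeros _ _ (fun=> fun=> 1)) => ? _; exact: polynomial_const.
apply: (zclosed_ext _ (zclosed_or (cS x) IH)) => h _; split=> [[Sx|[y ys Sy]]|[y]].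
- by exists x; rewrite ?mem_head.
- by exists y; rewrite // inE ys orbT.
rewrite inE => /orP [/eqP ->|ys] Sy; [by left|by right; exists y].
Qed.

End Closed.

Lemma zariski_closedP n (Z : set (subspaces F n)) : Z `<=` @Fl F n ->
  zclosed (fun h => Z (flag_of h)) -> zariski_closed Z.
Proof.
move=> ZF [E [pE HE]]; split=> //.
exists [set p | exists2 f, E f & forall h : 'M[F]_n, mpoly.meval (fun k => mxvec h 0 k) p = f h].
move=> h hu; rewrite HE //; split=> [H p [f Ef ->]|H f Ef]; first exact: H.
by have [p Hp] := pE f Ef; rewrite -Hp; apply: H; exists f.
Qed.

End Polynomial.

(** * Closedness of rank conditions and of the quasisymmetric flag variety *)

Section Rank.
Variable F : fieldType.

(** Submatrices have smaller rank, and a matrix has an invertible submatrix whose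
    size is its rank: select independent rows, then independent columns. *)
Lemma mxrank_minorsP m n (M : 'M[F]_(m, n)) r : (\rank M <= r)%N <->
  forall k (f : 'I_k -> 'I_m) (g : 'I_k -> 'I_n), (r < k)%N -> \det (mxsub f g M) = 0.
Proof.
split=> [Mr k f g rk|H].
  apply/eqP; apply: contraLR rk => d0; rewrite -leqNgt (leq_trans _ Mr) //.
  have <- : \rank (mxsub f g M) = k by apply: mxrank_unit; rewrite unitmxE unitfE.
  rewrite mxsubrc (leq_trans (mxrankS (rowsub_sub _ _))) //.
  by rewrite -mxrank_tr trmx_mxsub -[leqRHS]mxrank_tr mxrankS // rowsub_sub.
rewrite leqNgt; apply/negP=> rM.
pose N := rowsub (maxrankfun M) M.
have NF : row_full N^T.
  by rewrite /row_full mxrank_tr; have := maxrowsub_free M.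
have := fullrowsub_unit NF; rewrite -unitmx_tr trmx_mxsub trmxK unitmxE unitfE.
by rewrite /N -mxsubcr H ?eqxx.
Qed.

Lemma zclosed_corner_rank n p q r :
  zclosed (fun h : 'M[F]_n => (\rank (corner p q h) <= r)%N).
Proof.
pose T := {k : nat & (('I_k -> 'I_n) * ('I_k -> 'I_n))%type}.
pose P (x : T) := (r < tag x)%N.
pose f (x : T) (h : 'M[F]_n) := \det (mxsub (tagged x).1 (tagged x).2 (corner p q h)).
apply: (@zclosed_ext _ _ (fun h => forall x, P x -> f x h = 0)).
  move=> h _; rewrite mxrank_minorsP; split=> H; last by move=> [k [a b]]; apply: H.
  by move=> k a b rk; apply: (H (existT _ k (a, b))).
apply: zclosed_zeros => x _; apply: polynomial_det => i j.
have [e|e] := boolP ((p <= (tagged x).1 i)%N && ((tagged x).2 j < q)%N).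
  have [s Hs] := polynomial_entry F ((tagged x).1 i) ((tagged x).2 j).
  by exists s => h; rewrite Hs !mxE e.
have [s Hs] := polynomial_const n (0 : F).
by exists s => h; rewrite Hs !mxE (negbTE e).
Qed.
End Rank.

Section PinsClosed.
Variables (F : fieldType) (n : nat).
Implicit Types (i : 'I_n) (h : 'M[F]_n.+1).

(** If the flag of [h] lies in P_i of a flag V, then deleting row i kills e_i, and
    the columns of [h] other than column [t] represent V after that, whenever they
    are still independent; [t] is one of [low i] and [high i]. *)
Definition drop_entry i (t : 'I_n.+1) h : 'M[F]_n := row' (low i) (col' t h).

Lemma drop_entryE i t h x y : drop_entry i t h x y = h (lift (low i) x) (lift t y).
Proof. by rewrite 2!mxE. Qed.

Lemma cofactor_eq0 i t h : (cofactor h (low i) t == 0) = (\det (drop_entry i t h) == 0).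
Proof. by rewrite /cofactor mulf_eq0 signr_eq0. Qed.

Lemma invmx_eq0 i t h : h \in unitmx ->
  (invmx h t (low i) == 0) = (\det (drop_entry i t h) == 0).
Proof.
move=> hu; rewrite -cofactor_eq0 /invmx hu !mxE mulf_eq0 invr_eq0.
by have := hu; rewrite unitmxE unitfE => /negbTE ->.
Qed.

(** The first condition says that the subspace of dimension i has i-th coordinate
    zero, the second, by Cramer's rule, that e_i is in the subspace of dimension
    i + 2. *)
Definition pins_conditions i (Z : set (subspaces F n)) h : Prop :=
  [/\ forall j : 'I_n.+1, (j < i)%N -> h (low i) j = 0,
      forall k : 'I_n.+1, (high i < k)%N -> \det (drop_entry i k h) = 0 &
      forall t, t \in [:: low i; high i] -> drop_entry i t h \in unitmx ->
        Z (flag_of (drop_entry i t h))].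

Lemma Pins_conditions i Z h : Z `<=` @Fl F n -> h \in unitmx ->
  Pins i Z (flag_of h) -> pins_conditions i Z h.
Proof.
move=> ZF hu /PinsP [//|_ [A [Au ZA HA]]].
have h'u := unitmx_insert (low i) (high i) Au; set h' := insert_mx _ _ A in h'u HA.
split.
- move=> j ji; pose I : 'I_n.+2 := widen_ord (leqnSn _) (low i).
  have : col j h \in flag_of h I by apply: col_in_flag.
  rewrite HA /=; last by lia.
  rewrite -ins0_flag_low //= => /memv_imgP [u _ /colP/(_ (low i))].
  by rewrite ins0_diag mxE.
- move=> k hk; apply/eqP; rewrite -invmx_eq0 //; apply/eqP.
  pose K : 'I_n.+2 := lift ord0 (high i).
  have KE : K = i.+2 :> nat by rewrite /K /= /bump.
  have eK : basis_vec F (low i) \in flag_of h K.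
    rewrite HA ?KE; last by lia.
    by rewrite -(col_insert (low i) (high i) A) col_in_flag // KE /= /bump; lia.
  have := flag_coord0 hu eK (k := k); rewrite KE => /(_ _).
  by rewrite /basis_vec -colE mxE; apply; move: hk; rewrite /= /bump; lia.
move=> t ti Mu; set g := invmx h' *m h.
have tE : t = low i \/ t = high i.
  by move: ti; rewrite !inE => /orP [/eqP|/eqP]; [left|right].
pose b : 'M[F]_n := \matrix_(x, y) g (lift (high i) x) (lift t y).
have ME : drop_entry i t h = A *m b.
  apply/matrixP=> x y; rewrite drop_entryE -[h](mulKVmx h'u) -/g !mxE.
  rewrite (bigD1_ord (high i)) //= insert_mx_col mul0r add0r.
  by apply: eq_bigr => z _; rewrite insert_mx_lift !mxE.
have bb : borel F n b.
  split; first by move: Mu; rewrite ME unitmx_mul => /andP [].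
  move=> x y yx; rewrite mxE.
  have jn : (lift (high i) x < n.+2)%N by rewrite ltnW // ltnS.
  apply: (@flag_transition _ _ h' h (Ordinal jn)) => //=; last first.
    by case: tE => ->; rewrite /= /bump; lia.
  by rewrite HA //= /bump; lia.
by rewrite ME flag_of_borel.
Qed.

(** Under the first two conditions only two terms remain in the expansion of the
    determinant of [h] along row i, so one of the two submatrices is
    invertible. *)
Lemma conditions_Pins i Z h : Z `<=` @Fl F n -> h \in unitmx ->
  pins_conditions i Z h -> Pins i Z (flag_of h).
Proof.
move=> ZF hu [H1 H2 H3].
have [t ti Mu] : exists2 t, t \in [:: low i; high i] & drop_entry i t h \in unitmx.
  apply: contrapT => nex.
  have nu t : t \in [:: low i; high i] -> cofactor h (low i) t = 0.
    move=> ti; apply/eqP; rewrite cofactor_eq0; apply/negPn/negP=> nz.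
    by apply: nex; exists t => //; rewrite unitmxE unitfE.
  have := hu; rewrite unitmxE unitfE (expand_det_row _ (low i)) big1 ?eqxx // => k _.
  have [ki|ik] := ltnP k i; first by rewrite H1 ?mul0r.
  have [kh|hk] := leqP k (high i); last first.
    by apply/eqP; rewrite mulf_eq0 cofactor_eq0 H2 ?eqxx ?orbT.
  rewrite nu ?mulr0 // !inE -!(inj_eq val_inj) /=.
  by move: kh; rewrite /= /bump; lia.
have tE : t = low i \/ t = high i.
  by move: ti; rewrite !inE => /orP [/eqP|/eqP]; [left|right].
apply/PinsP => //; split; first exact: flag_of_is_flag.
set A := drop_entry i t h in Mu; exists A; split=> // [|j ji]; first exact: H3.
have h'u := unitmx_insert (low i) (high i) Mu.
have col_E (k : 'I_n) : ins0 F (low i) (col k A) =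
    col (lift t k) h - h (low i) (lift t k) *: basis_vec F (low i).
  apply/colP=> x; rewrite [RHS]mxE [X in X + _]mxE [X in _ + X]mxE [X in _ - X]mxE.
  case: (unliftP (low i) x) => [x' ->|->].
    by rewrite ins0_lift !mxE eq_sym (negbTE (neq_lift _ _)) mulr0 subr0.
  by rewrite ins0_diag !mxE !eqxx mulr1 subrr.
have [ji'|ij] := ltnP j i.+1.
  apply: flag_of_eqP => // k kj.
  have [|k' ke [kk _]] := @unlift_highP n i k.
    by rewrite -(inj_eq val_inj) /= /bump; lia.
  have k'i : (k' < i)%N by lia.
  have kt : k = lift t k'.
    apply/val_inj; rewrite ke; case: tE => ->; rewrite /= /bump; lia.
  have -> : col k h = col k (insert_mx (low i) (high i) A).
    rewrite [in RHS]ke col_insert_lift col_E -kt H1 ?scale0r ?subr0 //; lia.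
  exact: col_in_flag.
have {ij ji} ij : (i.+1 < j)%N by lia.
have eh : basis_vec F (low i) \in flag_of h j.
  have -> : basis_vec F (low i) = \sum_k (invmx h k (low i)) *: col k h.
    rewrite -[LHS](mulKVmx hu) /basis_vec -colE; apply/colP=> x; rewrite mxE summxE.
    by apply: eq_bigr => k _; rewrite !mxE mulrC.
  apply: rpred_sum => k _; have [kh|hk] := leqP k (high i).
    by rewrite rpredZ // col_in_flag //; move: kh; rewrite /= /bump; lia.
  have /eqP -> : invmx h k (low i) == 0 by rewrite invmx_eq0 // H2.
  by rewrite scale0r rpred0.
apply/esym/flag_of_eqP => // k kj.
case: (unliftP (high i) k) kj => [k' ->|->] kj; last by rewrite col_insert.
rewrite col_insert_lift col_E rpredB ?rpredZ // col_in_flag //.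
by move: kj; case: tE => ->; rewrite /= /bump; lia.
Qed.

(** The third condition becomes polynomial when the equations of [Z] are multiplied
    by the determinant of the submatrix. *)
Lemma zclosed_Pins i (Z : set (subspaces F n)) : Z `<=` @Fl F n ->
  zclosed (fun h : 'M[F]_n => Z (flag_of h)) ->
  zclosed (fun h : 'M[F]_n.+1 => Pins i Z (flag_of h)).
Proof.
move=> ZF [E [pE HE]].
have pdrop t x y : is_polynomial (fun h : 'M[F]_n.+1 => drop_entry i t h x y).
  have [p Hp] := polynomial_entry F (lift (low i) x) (lift t y).
  by exists p => h; rewrite Hp drop_entryE.
pose P (x : 'I_n.+1 * ('M[F]_n -> F)) := x.1 \in [:: low i; high i] /\ E x.2.
apply: (@zclosed_ext _ _ (fun h => (forall j : 'I_n.+1, (j < i)%N -> h (low i) j = 0) /\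
  ((forall k : 'I_n.+1, (high i < k)%N -> \det (drop_entry i k h) = 0) /\
   (forall x, P x -> \det (drop_entry i x.1 h) * x.2 (drop_entry i x.1 h) = 0)))).
  move=> h hu; split=> [[H1 [H2 H3]]|/(Pins_conditions ZF hu) [H1 H2 H3]].
    apply: conditions_Pins => //; split=> // t ti Mu; apply/HE => // f Ef.
    have /eqP := H3 (t, f) (conj ti Ef); rewrite mulf_eq0 /=.
    by move: Mu; rewrite unitmxE unitfE => /negbTE -> /eqP.
  do 2!split=> //; move=> [t f] [/= ti Ef]; apply/eqP; rewrite mulf_eq0.
  have [//|nz] := eqVneq; have Mu : drop_entry i t h \in unitmx by rewrite unitmxE unitfE.
  by apply/eqP; apply: (HE _ Mu).1 Ef; apply: H3.
apply: zclosed_and; last apply: zclosed_and.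
- by apply: zclosed_zeros => j _; apply: polynomial_entry.
- by apply: zclosed_zeros => k _; apply: polynomial_det.
apply: zclosed_zeros => -[t f] [/= _ Ef]; apply: polynomialM; first exact: polynomial_det.
by apply: polynomial_comp => //; apply: pE.
Qed.

End PinsClosed.

Lemma zclosed_QFl (F : fieldType) n : (0 < n)%N ->
  zclosed (fun h : 'M[F]_n => QFl F n (flag_of h)).
Proof.
case: n => // n _; elim: n => [|m IH].
  apply: (@zclosed_ext _ _ (fun h => forall x : unit, True -> (0 : F) = 0)).
    move=> h hu; split=> // _; exists (fun j => ord0) => //.
    exact: flag_of_is_flag.
  by apply: (@zclosed_zeros _ _ _ _ (fun=> fun=> 0)) => ? _; exact: polynomial_const.
apply: (@zclosed_ext _ _ (fun h => exists i, Pins i (QFl F m.+1) (flag_of h))).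
  by move=> h _; rewrite QFl_step.
apply: zclosed_exists => i; apply: zclosed_Pins IH; exact: QFl_sub.
Qed.

(** * The paving by the cells *)

Section Paving.
Variables (F : fieldType) (n : nat).
Hypothesis n_gt0 : (0 < n)%N.

Lemma MNCB_disjoint (v w : 'S_n) V : MNCB F v V -> MNCB F w V -> v = w.
Proof. by move=> /MNC_cell vV /MNC_cell wV; apply: bruhat_cell_disjoint vV wV. Qed.

Lemma QFl_cell (w : 'S_n) : w \in NC n -> QFl F n `&` bruhat_cell F w = MNCB F w.
Proof.
move=> wNC; apply/seteqP; split=> V.
  case=> /(QFlP _ n_gt0) [v vNC Vv] Vw.
  by rewrite -(bruhat_cell_disjoint (MNC_cell Vv) Vw).
by move=> Vw; split; [apply/QFlP => //; exists w|exact: MNC_cell].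
Qed.

Lemma QFl_bigcup : QFl F n = \bigcup_(w in [set` NC n]) MNCB F w.
Proof.
apply/seteqP; split=> V; first by case/(QFlP _ n_gt0) => w wNC Vw; exists w.
by case=> w wNC Vw; apply/QFlP => //; exists w.
Qed.

Section Ordering.
Variable w_ : 'I_#|NC n| -> 'S_n.
Hypotheses (w_inj : injective w_) (w_NC : forall k, w_ k \in NC n).

Lemma NC_ordering_onto v : v \in NC n -> exists k, v = w_ k.
Proof.
have onto : (w_ @: predT)%SET = NC n.
  apply/eqP; rewrite eqEcard card_imset // card_ord leqnn andbT.
  by apply/fintype.subsetP=> _ /imsetP [k _ ->]; exact: w_NC.
by move=> vNC; move: (vNC); rewrite -{1}onto => /imsetP [k _ ->]; exists k.
Qed.

Let X (k : nat) := \bigcup_(i in [set i : 'I_#|NC n| | (i < k)%N]) MNCB F (w_ i).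

(** This is where the ordering must extend the Bruhat order: a flag of [QFl] in the
    cell of v that satisfies the rank bounds of [w_ i] has v dominated by
    [w_ i]. *)
Lemma bigcup_MNCB_closed k :
  (forall k l, bruhat (w_ k) (w_ l) -> (k <= l)%N) -> zariski_closed (X k).
Proof.
move=> w_bruhat; apply: zariski_closedP; first by move=> V [i _]; apply: MNCB_flag.
pose T := {i : 'I_#|NC n| | (i < k)%N}.
apply: (@zclosed_ext _ _ (fun h => QFl F n (flag_of h) /\
    exists i : T, forall pq : nat * nat,
      (\rank (corner pq.1 pq.2 h) <= rank_count (w_ (val i)) pq.1 pq.2)%N)).
  move=> h hu; split=> [[/(QFlP _ n_gt0) [v vNC Vv] [[i ik] Hi]]|[i ik Vi]].
    have [l vl] := NC_ordering_onto vNC; rewrite vl in Vv.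
    exists l => //=; apply: (leq_ltn_trans _ (ik)); apply/w_bruhat/dominated_bruhat => p q.
    by rewrite -(bruhat_cell_rank _ _ hu (MNC_cell Vv)) (Hi (p, q)).
  split; first by apply/QFlP => //; exists (w_ i).
  by exists (exist _ i ik) => pq; rewrite (bruhat_cell_rank _ _ hu (MNC_cell Vi)).
apply: zclosed_and; first exact: zclosed_QFl.
by apply: zclosed_exists => i; apply: zclosed_all => pq; apply: zclosed_corner_rank.
Qed.

End Ordering.
End Paving.

Theorem theorem9p7 (R : realType) (n : nat) (hn : (1 <= n)%N) :
  [/\ (forall w : 'S_n, w \in NC n ->
         QFl R[i] n `&` bruhat_cell R[i] w = MNCB R[i] w),
      (QFl R[i] n = \bigcup_(w in [set` NC n]) MNCB R[i] w
       /\ trivIset [set` NC n] (fun w : 'S_n => MNCB R[i] w)) &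
      (forall w_ : 'I_#|NC n| -> 'S_n,
         injective w_ -> (forall k, w_ k \in NC n) ->
         (forall k l, bruhat (w_ k) (w_ l) -> (k <= l)%N) ->
         let X (k : nat) :=
           \bigcup_(i in [set i : 'I_#|NC n| | (i < k)%N]) MNCB R[i] (w_ i) in
         [/\ forall k, (1 <= k <= #|NC n|)%N -> zariski_closed (X k),
             forall k, (1 <= k < #|NC n|)%N -> X k `<=` X k.+1,
             X #|NC n| = QFl R[i] n &
             forall k : 'I_#|NC n|, (1 <= k)%N ->
               X k.+1 `\` X k = MNCB R[i] (w_ k)])].
Proof.
split; first by move=> w; apply: QFl_cell.
  split; first exact: QFl_bigcup.
  by move=> v w _ _ [V [Vv Vw]]; apply: MNCB_disjoint Vv Vw.
move=> w_ w_inj w_NC w_bruhat X; split.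
- by move=> k _; apply: bigcup_MNCB_closed.
- by move=> k _ V [i /= ik Vi]; exists i => //=; apply: ltnW.
- rewrite QFl_bigcup //; apply/seteqP; split=> V.
    by case=> i _ Vi; exists (w_ i) => //=.
  case=> v /= /(NC_ordering_onto w_inj w_NC) [i ->] Vi.
  by exists i => //=.
move=> k _; apply/seteqP; split=> V.
  case=> -[i /= ik Vi] nX; have [/eqP/val_inj <- //|ne] := boolP (i == k :> nat).
  by case: nX; exists i => //=; rewrite ltn_neqAle ne -ltnS.
move=> Vk; split; first by exists k => /=.
case=> i /= ik Vi; have /w_inj e := MNCB_disjoint Vi Vk.
by rewrite e ltnn in ik.
Qed.
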